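(* Let $p\equiv 1,9\pmod{40}$ be a prime, so that $p=c^2+d^2=x^2+10y^2$ with $c,d,x,y\in\mathbb Z$. Suppose $c\equiv 1\pmod 4$, $d=2^rd_0$ and $d_0\equiv 1\pmod 4$. Assume $(c,x+d)=1$ or $(d_0,x+c)=1$. Then $$(-5)^{\frac{p-1}8}\equiv\begin{cases}\pm(-1)^{\frac d4+\frac{x-1}2+\frac y2}\pmod p&\text{if }\frac{2c-d}x\equiv\pm2\pmod 5,\\ \pm(-1)^{\frac d4+\frac{x-1}2+\frac y2}\frac cd\pmod p&\text{if }\frac{2c-d}x\equiv\pm1\pmod 5.\end{cases}$$
   Context: $(m,n)$ is the greatest common divisor; $r$ is a nonnegative integer. Fractions in congruences are interpreted via inverses modulo the modulus. In each line the upper signs are taken together and the lower signs are taken together. *)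

(* Defs.v *)
From mathcomp Require Import all_boot all_order all_algebra.
Set Implicit Arguments.
Unset Strict Implicit.
Unset Printing Implicit Defensive.

Import GRing.Theory.
Local Open Scope ring_scope.

(* The class of the fraction a / b modulo the prime q, with the inverse taken
   modulo q; it is meaningful when q is prime and does not divide b. *)
Definition frac_mod (q : nat) (a b : int) : 'F_q := a%:~R / b%:~R.

(* Main.v *)
Require Import Defs.
From mathcomp Require Import all_boot all_order all_algebra.
From mathcomp Require Import all_field zify ring.
Set Implicit Arguments.
Unset Strict Implicit.
Unset Printing Implicit Defensive.

Import GRing.Theory Num.Theory.
Local Open Scope ring_scope.

(** Let pi = c + d i.  Reducing Gaussian integers modulo pi sends i to
    u = - c / d in the field with p elements.  Since x^2 = - 10 y^2 and
    (1 + i)^2 = 2 i, one has - 5 = u (x / (y (1 + u)))^2, hence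
    (-5)^((p-1)/8) is the power of u with exponent
       [x/pi] - [y/pi] - [(1+i)/pi] + (p-1)/8   modulo 4,
    where [z/w] in Z/4 is the exponent of i in the quartic residue symbol of
    z modulo w.  Everything is a matter of computing these symbols.

    The tool is quartic reciprocity between an odd prime q and a Gaussian
    integer w = a + b i with a, b coprime and b even (quartic_reciprocity).
    With q' = q or - q congruent to 1 modulo 4, it says that in
    characteristic q
       i^[q'/w] = (w / conj w)^((q' - 1)/4).
    For w of prime norm it comes from raising a quartic Gauss sum to the q-th
    power, the fourth power of the sum being w^3 conj w when w is the Jacobi
    sum; the general case follows by splitting such primes off w.  Thus, for
    n congruent to 1 modulo 4, [n/w] depends only on the ratio w / conj w
    modulo the primes dividing n (the lemmas gsym_ratio_...).

    This suffices for [c/pi], [(c+d)/pi] and, as c (1 + u) = c + d, for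
    [(1+i)/pi] and [2/pi].  For [x/pi] and [y/pi] an auxiliary Gaussian
    integer nu is used, with s = 1 + b i and
       2 nu = conj s x + s pi.
    Modulo a prime dividing x the ratio of nu is that of s pi; modulo a prime
    dividing 10 y, where p = x^2, it is pi / x, the square root of the ratio
    of pi; modulo a prime dividing the norm of s it is x / conj pi.  Modulo
    nu itself, 10 T y^2 = 2 x B i with 2 T = 1 + b^2 and 2 B the imaginary
    part of s^2 pi (nu_relation).  When this relation is turned into one
    between symbols over nu, reciprocity replaces [x/nu] by [x/pi] and twice
    the symbol of the odd part y0 of y by [y0/pi]; the symbols modulo s
    cancel.  What remains is [5/nu], which is read off pi / x modulo 5 and so
    produces the condition on (2c - d)/x, together with explicit polynomials
    modulo 4 (exponent_identity).

    The integer b, congruent to 1 modulo 4, is at our disposal; it is taken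
    divisible by x p and by the primes dividing 5 y that could otherwise divide
    nu, so that nu is primitive and all symbols make sense (auxiliary_slope).
*)

(** * Exponents modulo 4 *)

(** Symbols take their values in Z/4; expi turns such a value back into a
    fourth root of unity, once a square root j of -1 has been chosen. *)
Definition expi (R : nzRingType) (j : R) (k : 'Z_4) : R := j ^+ k.

Section Expi.
Variables (F : fieldType) (j : F).
Hypothesis j2 : j ^+ 2 = -1.

Lemma expr4_i : j ^+ 4 = 1.
Proof. by rewrite (exprM j 2 2) j2 expr2 mulrNN mulr1. Qed.

Lemma i_neq0 : j != 0.
Proof.
apply/eqP => j0; move: j2; rewrite j0 expr0n /= => /eqP.
by rewrite eq_sym oppr_eq0 oner_eq0.
Qed.

Lemma expi_nat n : expi j n%:R = j ^+ n.
Proof. by rewrite /expi val_Zp_nat // -(expr_mod n expr4_i). Qed.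

Lemma expiD k l : expi j (k + l) = expi j k * expi j l.
Proof. by rewrite -[k]natr_Zp -[l]natr_Zp -natrD !expi_nat exprD. Qed.

Lemma expi0 : expi j 0 = 1. Proof. by []. Qed.

Lemma expi1 : expi j 1 = j. Proof. by []. Qed.

Lemma expi2 : expi j 2 = -1. Proof. by rewrite /expi -j2. Qed.

Lemma expi3 : expi j 3 = - j. Proof. by rewrite /expi exprS j2 mulrN1. Qed.

Lemma expi_neq0 k : expi j k != 0.
Proof. by rewrite expf_neq0 // i_neq0. Qed.

Lemma expiN k : expi j (- k) = (expi j k)^-1.
Proof.
by apply: (mulfI (expi_neq0 k)); rewrite -expiD subrr divff ?expi_neq0.
Qed.

Lemma expiMn k n : expi j (k *+ n) = expi j k ^+ n.
Proof.
elim: n => [|n IHn]; first by rewrite mulr0n expr0.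
by rewrite mulrS expiD IHn exprS.
Qed.

Lemma expiMz k (z : int) : expi j (k *~ z) = expi j k ^ z.
Proof.
by case: z => n; rewrite ?pmulrn ?NegzE ?mulrNz ?expiN ?expiMn // -expfV exprz_inv.
Qed.

Lemma expi_int (z : int) : expi j z%:~R = j ^ z.
Proof. by rewrite expiMz expi1. Qed.

Lemma expi_eq1 k : (2 : F) != 0 -> expi j k = 1 -> k = 0.
Proof.
move=> two; have m1 : (-1 : F) != 1.
  by apply: contraNneq two => e; rewrite mulr2n -{1}e addNr.
case: k => [[|[|[|[|k]]]] lt_k] //; rewrite /expi /= => e; apply/val_inj => //=.
- by move: j2; rewrite -[j]expr1 e expr1n => /esym/eqP; rewrite (negbTE m1).
- by move: j2; rewrite e => /esym/eqP; rewrite (negbTE m1).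
- move: expr4_i; rewrite exprS e mulr1 => e1.
  by move: j2; rewrite e1 expr1n => /esym/eqP; rewrite (negbTE m1).
Qed.

Lemma expi_inj : (2 : F) != 0 -> injective (expi j).
Proof.
move=> two k l kl; apply/eqP; rewrite -subr_eq0; apply/eqP.
by apply: expi_eq1 => //; rewrite expiD expiN kl divff ?expi_neq0.
Qed.
End Expi.

(** * Completely additive functions on the positive integers *)

(** The completely additive function with prescribed values at the primes.
    Both the denominator and the numerator of a symbol are split into primes
    in this way. *)
Definition lsum (f : nat -> 'Z_4) (N : nat) : 'Z_4 :=
  \sum_(l <- primes N) f l *+ logn l N.

(** A range that does not depend on N, so that sums for several N compare. *)
Lemma lsum_wide f N M : (0 < N <= M)%N ->
  lsum f N = \sum_(0 <= l < M.+1 | prime l) f l *+ logn l N.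
Proof.
case/andP=> N0 NM; rewrite /lsum.
rewrite [RHS](bigID (fun l => l \in primes N)) /= [X in _ + X]big1 ?addr0.
  rewrite -[RHS]big_filter; apply: perm_big; apply: uniq_perm.
  - exact: primes_uniq.
  - by rewrite filter_uniq // iota_uniq.
  move=> l; rewrite mem_filter mem_index_iota /=.
  case: (boolP (l \in primes N)) => [lN|_]; last by rewrite andbF.
  move: (lN); rewrite mem_primes => /and3P[-> _ lN'] /=.
  by rewrite ltnS (leq_trans (dvdn_leq N0 lN')).
move=> l /andP[pl]; rewrite mem_primes pl N0 /= => lN.
by rewrite lognE pl N0 (negbTE lN) mulr0n.
Qed.

Lemma lsumM f M N : (0 < M)%N -> (0 < N)%N ->
  lsum f (M * N) = lsum f M + lsum f N.
Proof.
move=> M0 N0; have MN0 : (0 < M * N)%N by rewrite muln_gt0 M0.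
rewrite (@lsum_wide f _ (M * N)) ?MN0 ?leqnn //.
rewrite (@lsum_wide f M (M * N)) ?M0 ?leq_pmulr //.
rewrite (@lsum_wide f N (M * N)) ?N0 ?leq_pmull //.
rewrite -big_split /=; apply: eq_bigr => l _.
by rewrite lognM // mulrnDr.
Qed.

Lemma lsum1 f : lsum f 1 = 0.
Proof. by rewrite /lsum big_nil. Qed.

Lemma lsum_prime f l : prime l -> lsum f l = f l.
Proof. by move=> pl; rewrite /lsum primes_prime // big_seq1 logn_prime // eqxx. Qed.

Lemma eq_lsum f g N :
  (forall l, prime l -> l %| N -> f l = g l)%N -> lsum f N = lsum g N.
Proof.
move=> fg; apply: eq_big_seq => l; rewrite mem_primes => /and3P[pl _ lN].
by rewrite fg.
Qed.

Lemma lsumD f g N : lsum (fun l => f l + g l) N = lsum f N + lsum g N.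
Proof. by rewrite -big_split; apply: eq_bigr => l _; rewrite mulrnDl. Qed.

Lemma lsumN f N : lsum (fun l => - f l) N = - lsum f N.
Proof. by rewrite /lsum -sumrN; apply: eq_bigr => l _; rewrite mulNrn. Qed.

Lemma lsumMn f n N : lsum (fun l => f l *+ n) N = lsum f N *+ n.
Proof.
by rewrite /lsum -sumrMnl; apply: eq_bigr => l _; rewrite -!mulrnA mulnC.
Qed.

(** * Integers congruent to 1 modulo 4 *)

(** Quartic reciprocity is free of signs for rational numbers congruent to 1
    modulo 4; star q is the one among q and - q. *)
Definition star (q : nat) : int := if (q %% 4 == 1)%N then q%:Z else - q%:Z.

(** The exponent in the quartic power residue map of star q; it is negative
    for q congruent to 3 modulo 4, where the ratio w / conj w to which it is
    applied is inverted by Frobenius. *)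
Definition quarter (n : int) : int := ((n - 1) %/ 4)%Z.

Lemma star_mod4 q : odd q -> (star q = 1 %[mod 4])%Z.
Proof. rewrite /star; case: ifP => /eqP; lia. Qed.

Lemma absz_star q : `|star q|%N = q.
Proof. by rewrite /star; case: ifP => _; rewrite ?abszN. Qed.

Lemma star_1mod4 q : (q %% 4 = 1)%N -> let m := (q %/ 4)%N in
  [/\ star q = q, quarter (star q) = m & q = (m * 4).+1].
Proof. by move=> q4; rewrite /star q4 /quarter /=; split=> //; lia. Qed.

Lemma star_3mod4 q : (q %% 4 = 3)%N -> let m := (q %/ 4)%N in
  [/\ star q = - q%:Z, quarter (star q) = - m.+1%:Z & q = (m * 4 + 3)%N].
Proof. by move=> q4; rewrite /star q4 /quarter /=; split=> //; lia. Qed.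

Lemma odd_mod4 q : odd q -> (q %% 4 = 1)%N \/ (q %% 4 = 3)%N.
Proof. lia. Qed.

Lemma star_prod_ind (P : int -> Prop) : P 1 ->
  (forall q n, prime q -> odd q -> (n = 1 %[mod 4])%Z -> P n -> P (star q * n)) ->
  forall n, (n = 1 %[mod 4])%Z -> P n.
Proof.
move=> P1 PM n; have [k] := ubnP `|n|%N; elim: k n => // k IHk n nk n4.
have [n1|n1] := leqP `|n|%N 1%N.
  by suff -> : n = 1 by []; lia.
have pq := pdiv_prime n1; set q := pdiv `|n|%N in pq.
have oq : odd q.
  have : (q %| `|n|)%N by exact: pdiv_dvd.
  by case/dvdnP => e He; apply: contraT => ev; lia.
have /dvdnP[e He] : (q %| `|n|)%N by exact: pdiv_dvd.
have q1 := prime_gt1 pq.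
have [m nE] : exists m : int, n = star q * m.
  have : (star q %| n)%Z by rewrite dvdzE absz_star pdiv_dvd.
  by case/dvdzP => m ->; exists m; rewrite mulrC.
have q4 := star_mod4 oq.
have m4 : (m = 1 %[mod 4])%Z.
  by rewrite -n4 nE -modzMml q4 modzMml mul1r.
rewrite nE; apply: PM => //; apply: IHk => //.
have nm : `|n|%N = (q * `|m|)%N by rewrite nE abszM absz_star.
have m0 : (0 < `|m|)%N by move: nm n1; case: `|m|%N => [|//]; rewrite muln0 => ->.
by rewrite -ltnS (leq_trans _ nk) // ltnS nm ltn_Pmull.
Qed.

(** Modulo 4 only: the product of the two multiples of 4 is a multiple
    of 16. *)
Lemma quarterM (m n : int) : (m = 1 %[mod 4])%Z -> (n = 1 %[mod 4])%Z ->
  (quarter (m * n))%:~R = (quarter m)%:~R + (quarter n)%:~R :> 'Z_4.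
Proof.
move=> m4 n4; rewrite /quarter.
have [a ->] : exists a, m = 4 * a + 1 by exists ((m %/ 4)%Z); lia.
have [b ->] : exists b, n = 4 * b + 1 by exists ((n %/ 4)%Z); lia.
have qE k : ((4 * k + 1 - 1) %/ 4)%Z = k by lia.
have -> : (4 * a + 1) * (4 * b + 1) = 4 * (4 * (a * b) + a + b) + 1 by ring.
rewrite !qE !rmorphD rmorphM /=.
by rewrite (_ : 4%:~R = 0 :> 'Z_4) ?mul0r ?add0r //; apply/val_inj.
Qed.

(** The way in which symbols with rational numerator are reduced to prime
    numerators.  S stands for coprimality to the denominator, outside of which
    the symbols are not additive. *)
Lemma additive_star (h : int -> 'Z_4) (S : int -> Prop) : h 1 = 0 ->
  (forall m n, S (m * n) -> S m /\ S n) ->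
  (forall m n, S m -> S n -> (m = 1 %[mod 4])%Z -> (n = 1 %[mod 4])%Z ->
     h (m * n) = h m + h n) ->
  forall n, (n = 1 %[mod 4])%Z -> S n -> h n = lsum (fun q => h (star q)) `|n|%N.
Proof.
move=> h1 SM hM; apply: star_prod_ind => [_|q n pq oq n4 IHn /SM[Sq Sn]].
  by rewrite lsum1.
have n0 : (0 < `|n|)%N by rewrite absz_gt0; apply/eqP => n0; rewrite n0 in n4.
rewrite hM ?star_mod4 // IHn // abszM absz_star lsumM //; last exact: prime_gt0.
by rewrite (lsum_prime _ pq).
Qed.

Lemma quarter_star n : (n = 1 %[mod 4])%Z ->
  (quarter n)%:~R = lsum (fun q => (quarter (star q))%:~R) `|n|%N.
Proof.
move=> n4; apply: (additive_star (h := fun n => (quarter n)%:~R) (S := fun=> True)) => //.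
by move=> k l _ _; exact: quarterM.
Qed.

(** * Quartic characters of prime fields *)

Lemma intr_Fp_eq0 l (n : int) : prime l -> (n%:~R == 0 :> 'F_l) = (l %| n)%Z.
Proof. by move=> pl; rewrite (dvdz_pcharf (pchar_Fp pl)). Qed.

Lemma two_Fp_neq0 l : prime l -> odd l -> (2 : 'F_l) != 0.
Proof.
move=> pl ol; have := intr_Fp_eq0 2 pl; rewrite /= => ->.
by rewrite dvdzE /= dvdn_prime2 //; apply: contraTneq ol => ->.
Qed.

Lemma sqrtN1_mod4 l (u : 'F_l) : prime l -> odd l -> u ^+ 2 = -1 -> (l %% 4 = 1)%N.
Proof.
move=> pl ol u2; have two := two_Fp_neq0 pl ol.
have [//|l3] : (l %% 4 = 1 \/ l %% 4 = 3)%N by lia.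
have lE : l = (2 * (l %/ 4).*2.+1).+1 by lia.
have : u ^+ (2 * (l %/ 4).*2.+1).+1 = u.
  by rewrite -lE -[in RHS](expf_card u) card_Fp.
rewrite exprS exprM u2 -signr_odd /= odd_double /= mulrN1 => /eqP.
rewrite eq_sym -subr_eq0 opprK -mulr2n -mulr_natl mulf_eq0 (negbTE two).
by rewrite (negbTE (i_neq0 u2)).
Qed.

(** The logarithm to the base u of the quartic residue symbol of t.  It is
    only meaningful for u^2 = -1 and t nonzero. *)
Definition qlog l (u t : 'F_l) : 'Z_4 :=
  let s := t ^+ ((l - 1) %/ 4) in
  if s == 1 then 0 else if s == u then 1 else if s == -1 then 2 else 3.

Section QuarticLog.
Variables (l : nat) (u : 'F_l).
Hypotheses (pl : prime l) (ol : odd l) (u2 : u ^+ 2 = -1).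

Let two := two_Fp_neq0 pl ol.

Lemma Fermat_Fp (t : 'F_l) : t != 0 -> t ^+ (l - 1) = 1.
Proof.
move=> t0; apply: (mulfI t0); rewrite -exprS subn1 prednK ?prime_gt0 //.
by rewrite mulr1 -[in RHS](expf_card t) card_Fp.
Qed.

Lemma qlogP (t : 'F_l) : t != 0 -> expi u (qlog u t) = t ^+ ((l - 1) %/ 4).
Proof.
move=> t0; have l4 := sqrtN1_mod4 pl ol u2; rewrite /qlog.
set s := t ^+ _; have s4 : s ^+ 4 = 1.
  by rewrite -exprM -[RHS](Fermat_Fp t0); congr (_ ^+ _); lia.
case: eqP => [->|/eqP s1]; first by rewrite expi0.
case: eqP => [->|/eqP su]; first by rewrite expi1.
case: eqP => [->|/eqP sm]; first by rewrite expi2.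
rewrite expi3 //; apply/eqP; rewrite eq_sym -addr_eq0.
have : (s - 1) * (s - u) * (s + 1) * (s + u) == 0.
  have -> : (s - 1) * (s - u) * (s + 1) * (s + u) =
    s ^+ 4 - 1 - (s ^+ 2 - 1) * (u ^+ 2 + 1) by ring.
  by rewrite s4 u2 addNr mulr0 !subrr.
by rewrite !mulf_eq0 !subr_eq0 !addr_eq0 (negbTE s1) (negbTE su) (negbTE sm).
Qed.

Lemma qlog_unique k (t : 'F_l) : t != 0 ->
  t ^+ ((l - 1) %/ 4) = expi u k -> qlog u t = k.
Proof. by move=> t0 tk; apply: (expi_inj u2 two); rewrite qlogP. Qed.

Lemma qlogM s t : s != 0 -> t != 0 -> qlog u (s * t) = qlog u s + qlog u t.
Proof.
move=> s0 t0; apply: qlog_unique; first by rewrite mulf_neq0.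
by rewrite expiD // !qlogP // exprMn.
Qed.

Lemma qlog1 : qlog u 1 = 0.
Proof. by rewrite /qlog expr1n eqxx. Qed.

Lemma qlogV t : t != 0 -> qlog u t^-1 = - qlog u t.
Proof.
move=> t0; apply/eqP; rewrite -addr_eq0 -qlogM ?invr_eq0 //.
by rewrite mulVf // qlog1.
Qed.

Lemma qlogX t n : t != 0 -> qlog u (t ^+ n) = qlog u t *+ n.
Proof.
move=> t0; elim: n => [|n IHn]; first by rewrite qlog1.
by rewrite exprS qlogM ?expf_neq0 // IHn mulrS.
Qed.

Lemma qlog_i : qlog u u = ((l - 1) %/ 4)%:R.
Proof. by apply: qlog_unique; rewrite ?i_neq0 ?expi_nat. Qed.

Lemma qlog_N1 : qlog u (-1) *+ 2 = 0.
Proof. by rewrite -qlogX ?oppr_eq0 ?oner_eq0 // sqrrN expr1n qlog1. Qed.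

(** The polynomial X^((l-1)/2) - 1 has too small a degree to vanish on all
    nonzero elements. *)
Lemma qlog_nonsquare : exists2 t, t != 0 & qlog u t *+ 2 != 0.
Proof.
have l4 := sqrtN1_mod4 pl ol u2.
have l1 := prime_gt1 pl.
pose p : {poly 'F_l} := 'X^((l - 1) %/ 2) - 1.
have m0 : (0 < (l - 1) %/ 2)%N by lia.
have sp : size p = ((l - 1) %/ 2).+1 by rewrite size_XnsubC.
case: (pickP [pred t : 'F_l | (t != 0) && (qlog u t *+ 2 != 0)]) => /= [t /andP[]|H].
  by exists t.
have /max_poly_roots : p != 0 by rewrite -size_poly_gt0 sp.
move=> /(_ (enum [pred t : 'F_l | t != 0])) /(_ _ (enum_uniq _)) => A.
suff : ((l - 1) < size p)%N by rewrite sp; lia.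
have -> : (l - 1)%N = size (enum [pred t : 'F_l | t != 0]).
  by rewrite -cardE (cardC1 0) card_Fp // subn1.
apply: A; apply/allP => t; rewrite mem_enum inE => t0.
have := H t; rewrite /= t0 /= => /negbFE/eqP qt.
rewrite /root !hornerE /= subr_eq0 (_ : ((l - 1) %/ 2 = (l - 1) %/ 4 * 2)%N); last lia.
by rewrite exprM -qlogP // -expiMn // qt expi0.
Qed.

End QuarticLog.

(** * Quartic Gauss sums *)

Section GaussSums.
Variables (l : nat) (u : 'F_l).
Hypotheses (pl : prime l) (ol : odd l) (u2 : u ^+ 2 = -1).
Variables (K : fieldType) (z j : K).
Hypotheses (zl : z ^+ l = 1) (z1 : z != 1) (j2 : j ^+ 2 = -1).
Hypotheses (twoK : (2 : K) != 0).

(** The e-th power of the quartic character, with values in a field K that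
    contains a square root j of -1; z is an l-th root of unity of K. *)
Definition qchar (e : nat) (t : 'F_l) : K :=
  if t == 0 then 0 else expi j (qlog u t *+ e).

Definition addchar (t : 'F_l) : K := z ^+ t.

Definition gauss e : K := \sum_t qchar e t * addchar t.

Definition jac e : K := \sum_t qchar e t * qchar e (1 - t).

Lemma qchar0 e : qchar e 0 = 0. Proof. by rewrite /qchar eqxx. Qed.

Lemma qchar_neq0 e t : t != 0 -> qchar e t != 0.
Proof. by move=> t0; rewrite /qchar (negbTE t0) expi_neq0. Qed.

Lemma qcharM e s t : qchar e (s * t) = qchar e s * qchar e t.
Proof.
rewrite /qchar mulf_eq0; have [->|s0] := eqVneq s 0; first by rewrite !mul0r.
have [->|t0] := eqVneq t 0; first by rewrite orbT !mulr0.
by rewrite qlogM // mulrnDl expiD.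
Qed.

Lemma qcharD e e' t : qchar (e + e') t = qchar e t * qchar e' t.
Proof.
rewrite /qchar; case: eqP => _; first by rewrite mul0r.
by rewrite mulrnDr expiD.
Qed.

Lemma qchar_mod e t : qchar e t = qchar (e %% 4) t.
Proof.
rewrite /qchar; case: eqP => // _; rewrite {1}(divn_eq e 4) mulrnDr mulnC mulrnA.
by rewrite -(mulr_natr (qlog u t)) (_ : 4%:R = 0) ?mulr0 ?mul0rn ?add0r //; apply/val_inj.
Qed.

Lemma qchar4 t : t != 0 -> qchar 4 t = 1.
Proof. by move=> t0; rewrite qchar_mod /qchar (negbTE t0) mulr0n. Qed.

Lemma qchar2_N1 : qchar 2 (-1) = 1.
Proof. by rewrite /qchar oppr_eq0 oner_eq0 qlog_N1. Qed.

(** A character that is not trivial sums to zero; odd and even e alike are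
    detected by a nonsquare. *)
Lemma sum_qchar e : (0 < e < 4)%N -> \sum_t qchar e t = 0.
Proof.
move=> e4; have [t0 t00 qt] := qlog_nonsquare pl ol u2.
have ct : qchar e t0 != 1.
  apply: contra qt => /eqP; rewrite /qchar (negbTE t00) => /(expi_eq1 j2 twoK) qt.
  case: e e4 qt => [|[|[|[|e]]]] //= _ qt.
  - by rewrite -[qlog u t0]mulr1n qt mul0rn.
  - by rewrite qt.
  - have : qlog u t0 *+ 3 *+ 2 = 0 by rewrite qt mul0rn.
    rewrite -mulrnA (mulrnDr _ 2 4) -(mulr_natr _ 4) (_ : 4%:R = 0) ?mulr0 ?addr0.
      by move=> ->.
    exact/val_inj.
apply/eqP; have : (qchar e t0 - 1) * \sum_t qchar e t = 0.
  rewrite mulrBl mul1r big_distrr /= [X in _ - X](reindex_inj (mulfI t00)).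
  by apply/eqP; rewrite subr_eq0; apply/eqP/eq_bigr => t _; rewrite qcharM.
by move/eqP; rewrite mulf_eq0 subr_eq0 (negbTE ct).
Qed.

Lemma addcharD s t : addchar (s + t) = addchar s * addchar t.
Proof.
rewrite /addchar -exprD -[RHS](expr_mod _ zl) /=.
by congr (_ ^+ (_ %% _)%N); rewrite Fp_cast.
Qed.

Lemma addchar0 : addchar 0 = 1. Proof. by []. Qed.

Lemma addcharMn t n : addchar (t *+ n) = addchar t ^+ n.
Proof. by elim: n => [|n IHn]; rewrite ?mulrS ?addcharD ?exprS ?IHn. Qed.

Lemma sum_addchar v :
  \sum_t addchar (t * v) = if v == 0 then l%:R else 0.
Proof.
have [->|v0] := eqVneq v 0.
  rewrite (eq_bigr (fun=> 1)) => [|t _]; last by rewrite mulr0 addchar0.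
  by rewrite sumr_const card_Fp.
have <- : \sum_t addchar t = \sum_t addchar (t * v).
  by rewrite (reindex_inj (mulIf v0)).
apply/eqP.
have : (z - 1) * \sum_t addchar t = 0.
  rewrite mulrBl mul1r big_distrr /= [X in _ - X](reindex_inj (addrI (1 : 'F_l))).
  apply/eqP; rewrite subr_eq0; apply/eqP/eq_bigr => t _; rewrite addcharD.
  by congr (_ * _); rewrite /addchar /= modn_small ?expr1 // Fp_cast ?prime_gt1.
by move/eqP; rewrite mulf_eq0 subr_eq0 (negbTE z1).
Qed.

(** After s = r t, the inner sum over t of the additive character of
    t (r + 1) vanishes unless r = -1. *)
Lemma gauss_conj e e' : (0 < e < 4)%N -> (e + e' = 4)%N ->
  gauss e * gauss e' = qchar e (-1) * l%:R.
Proof.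
move=> e4 ee'; rewrite /gauss big_distrlr /= exchange_big /=.
have inner t : t != 0 ->
  \sum_s qchar e s * addchar s * (qchar e' t * addchar t) =
  \sum_r qchar e r * addchar (t * (r + 1)).
- move=> t0; rewrite (reindex_inj (mulIf t0)); apply: eq_bigr => r _.
  rewrite qcharM mulrDr mulr1 addcharD (mulrC t r).
  transitivity (qchar e r * (qchar e t * qchar e' t) * addchar (r * t) * addchar t).
    move: (qchar e r) (qchar e t) (qchar e' t) (addchar _) (addchar _) => *; ring.
  by rewrite -qcharD ee' qchar4 // mulr1 mulrA.
rewrite (bigD1 0) //= qchar0 mul0r big1 ?add0r => [|s _]; last by rewrite mulr0.
rewrite (eq_bigr _ inner) exchange_big /=.
have outer r : \sum_(t | t != 0) qchar e r * addchar (t * (r + 1)) =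
  (if r == -1 then qchar e r * l%:R else 0) - qchar e r.
- rewrite -big_distrr /=; have := sum_addchar (r + 1); rewrite (bigD1 0) //= mul0r addchar0.
  rewrite addr_eq0 => /eqP; rewrite eq_sym addrC -subr_eq => /eqP <-.
  by case: eqP => _; ring.
rewrite (eq_bigr _ (fun r _ => outer r)) sumrB sum_qchar // subr0.
by rewrite -big_mkcond big_pred1_eq.
Qed.

(** Collect the terms of the square according to v = s + t; the terms with
    v = 0 cancel because the square of the character is not trivial.  For
    e = 1 and e = 3 alike this square is the quadratic character. *)
Lemma gauss_sq e : (e == 1)%N || (e == 3)%N -> gauss e ^+ 2 = jac e * gauss 2.
Proof.
move=> e13; have ee t : qchar e t * qchar e t = qchar 2 t.
  by rewrite -qcharD qchar_mod [in RHS]qchar_mod; case/orP: e13 => /eqP ->.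
rewrite expr2 /gauss big_distrlr /= (big_distrr (jac e)) /=.
transitivity (\sum_s \sum_v qchar e s * qchar e (v - s) * addchar v).
  apply: eq_bigr => s _; rewrite (reindex_inj (addrI (- s))); apply: eq_bigr => v _.
  rewrite addrC.
  have -> : addchar v = addchar s * addchar (v - s) by rewrite -addcharD addrC subrK.
  exact: mulrACA.
rewrite exchange_big; apply: eq_bigr => v _; rewrite -big_distrl /= mulrA.
congr (_ * _); have [->|v0] := eqVneq v 0.
  rewrite qchar0 mulr0 (eq_bigr (fun s => qchar e (-1) * qchar 2 s)) => [|s _].
    by rewrite -big_distrr /= sum_qchar // mulr0.
  rewrite sub0r -(mulN1r s) qcharM -ee.
  by move: (qchar e s) (qchar e (-1)) => a1 a2; ring.
rewrite (reindex_inj (mulfI v0)) /jac big_distrl /=; apply: eq_bigr => r _.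
have -> : v - v * r = v * (1 - r) by rewrite mulrBr mulr1.
rewrite !qcharM -(ee v).
by move: (qchar e v) (qchar e r) (qchar e (1 - r)) => a1 a2 a3; ring.
Qed.

Lemma gauss2_sq : gauss 2 ^+ 2 = l%:R.
Proof. by rewrite expr2 gauss_conj // qchar2_N1 mul1r. Qed.

(** Raising to the q-th power is additive in characteristic q; the
    substitution t := q t restores the additive character. *)
Lemma gauss_frobenius q : q \in [pchar K] -> q != l ->
  gauss 1 ^+ q = (qchar q q%:R)^-1 * gauss q.
Proof.
move=> chK ql; have pq : prime q := pcharf_prime chK.
have q0 : (q%:R : 'F_l) != 0.
  have := intr_Fp_eq0 q pl; rewrite /= => ->.
  by rewrite dvdzE /= dvdn_prime2 // eq_sym.
have -> : gauss 1 ^+ q = \sum_t (qchar 1 t * addchar t) ^+ q.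
  by rewrite -(pFrobenius_autE chK) rmorph_sum.
have qq : qchar q q%:R != 0 by rewrite qchar_neq0.
apply: (mulfI qq); rewrite mulVKf // /gauss big_distrr [RHS](reindex_inj (mulfI q0)) /=.
apply: eq_bigr => t _; rewrite qcharM mulr_natl addcharMn.
have -> : qchar q t = qchar 1 t ^+ q.
  rewrite /qchar; case: eqP => _; first by rewrite expr0n gtn_eqF ?prime_gt0.
  by rewrite -expiMn // mulr1n.
by rewrite exprMn mulrA.
Qed.
End GaussSums.

(** * Jacobi sums and rational quartic reciprocity *)

(** Real and imaginary part of i^k: they give the Jacobi sum as a Gaussian
    integer before any field is chosen. *)
Definition re4 (k : 'Z_4) : int := nth 0 [:: 1; 0; -1; 0] k.
Definition im4 (k : 'Z_4) : int := nth 0 [:: 0; 1; 0; -1] k.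

Lemma expi_re_im (K : fieldType) (j : K) k : j ^+ 2 = -1 ->
  expi j k = (re4 k)%:~R + (im4 k)%:~R * j.
Proof.
move=> j2; case: k => [[|[|[|[|k]]]] lt_k] //; rewrite /expi /re4 /im4 /=.
- by rewrite mul0r addr0.
- by rewrite expr1 mul1r add0r.
- by rewrite j2 mul0r addr0.
- by rewrite exprS j2 mulrN1 mulN1r add0r.
Qed.

Lemma re4_conj k : re4 (k *+ 3) = re4 k.
Proof. by case: k => [[|[|[|[|k]]]] lt_k]. Qed.

Lemma im4_conj k : im4 (k *+ 3) = - im4 k.
Proof. by case: k => [[|[|[|[|k]]]] lt_k]. Qed.

Lemma im4_double k : im4 (k + k) = 0.
Proof. by case: k => [[|[|[|[|k]]]] lt_k]. Qed.

Lemma closed_sqrtN1 (K : closedFieldType) : exists j : K, j ^+ 2 = -1.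
Proof.
have /closed_rootP[j] : size ('X^2 + 1 : {poly K}) != 1.
  by rewrite size_XnaddC.
by rewrite /root !hornerE addr_eq0 => /eqP jE; exists j.
Qed.

Lemma closed_unity_root (K : closedFieldType) l : (1 < l)%N -> (l%:R : K) != 0 ->
  exists2 z : K, z ^+ l = 1 & z != 1.
Proof.
move=> l1 l0; have /closed_rootP[z] : size (\poly_(i < l) (1 : K)) != 1.
  by rewrite size_poly_eq ?oner_eq0 // gtn_eqF.
rewrite /root horner_poly => /eqP zE; exists z.
  apply/eqP; rewrite -subr_eq0 subrX1; apply/eqP.
  suff -> : \sum_(i < l) z ^+ i = 0 by rewrite mulr0.
  by rewrite -[RHS]zE; apply: eq_bigr => i _; rewrite mul1r.
apply: contra l0 => /eqP z1; apply/eqP; rewrite -[RHS]zE z1.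
rewrite (eq_bigr (fun=> 1)) => [|i _]; last by rewrite expr1n mulr1.
by rewrite sumr_const card_ord.
Qed.

Section Reflection.
Variables (l : nat) (pl : prime l) (ol : odd l).

(** The involution t := 1 - t pairs the terms, except at its fixed point
    1/2. *)
Lemma even_sum_reflect (h : 'F_l -> int) : (forall t, h (1 - t) = h t) ->
  h 2^-1 = 0 -> (2 %| \sum_t h t)%Z.
Proof.
move=> hr h2; have two := two_Fp_neq0 pl ol.
pose P (t : 'F_l) := (t < (1 - t)%R)%N.
pose Q (t : 'F_l) := ((1 - t)%R < t)%N.
have -> : \sum_t h t = \sum_(t | P t) h t + \sum_(t | Q t) h t.
  rewrite (bigID P) /=; congr (_ + _); rewrite (bigID Q) /= addrC big1 ?add0r => [|t].
    apply: eq_bigl => t; rewrite /P /Q; apply/andb_idl => tt; rewrite -leqNgt; exact: ltnW.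
  rewrite /P /Q -!leqNgt => tt; have /val_inj tE : val t = val (1 - t)%R.
    by apply/eqP; rewrite eqn_leq; move: tt; rewrite andbC.
  rewrite -[RHS]h2; congr h; apply: (mulfI two); rewrite mulfV //.
  by rewrite mulr_natl mulr2n {1}tE subrK.
have -> : \sum_(t | Q t) h t = \sum_(t | P t) h t.
  rewrite (reindex_inj (inv_inj (fun t => subKr (1 : 'F_l) t))).
  by apply: eq_big => t; rewrite /P /Q ?subKr ?hr.
by apply/dvdzP; exists (\sum_(t | P t) h t); rewrite mulr_natr mulr2n.
Qed.

End Reflection.

Section PowerSums.
Variables (l : nat) (pl : prime l).

(** Multiplying t by an element g with g^k different from 1 multiplies the
    sum by g^k. *)
Lemma sum_expr_Fp k : (k < l - 1)%N -> \sum_(t : 'F_l) t ^+ k = 0.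
Proof.
have l1 := prime_gt1 pl.
case: k => [|k] kl.
  rewrite (eq_bigr (fun=> 1)) // sumr_const card_Fp //; exact: pchar_Fp_0.
have [g g0 gk] : exists2 g : 'F_l, g != 0 & g ^+ k.+1 != 1.
  case: (pickP [pred t : 'F_l | (t != 0) && (t ^+ k.+1 != 1)]) => /= [t /andP[]|H].
    by exists t.
  have sp : size ('X^(k.+1) - 1 : {poly 'F_l}) = k.+2 by rewrite size_XnsubC.
  have /max_poly_roots : ('X^(k.+1) - 1 : {poly 'F_l}) != 0 by rewrite -size_poly_gt0 sp.
  move=> /(_ (enum [pred t : 'F_l | t != 0])) /(_ _ (enum_uniq _)) A.
  suff : ((l - 1) < k.+2)%N by lia.
  rewrite -sp; have -> : (l - 1)%N = size (enum [pred t : 'F_l | t != 0]).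
    by rewrite -cardE (cardC1 0) card_Fp // subn1.
  apply: A; apply/allP => t; rewrite mem_enum inE => t0.
  have := H t; rewrite /= t0 /= => /negbFE/eqP qt.
  by rewrite /root !hornerE /= qt subrr.
apply/eqP; have : (g ^+ k.+1 - 1) * \sum_(t : 'F_l) t ^+ k.+1 = 0.
  rewrite mulrBl mul1r big_distrr /= [X in _ - X](reindex_inj (mulfI g0)).
  by apply/eqP; rewrite subr_eq0; apply/eqP/eq_bigr => t _; rewrite exprMn.
by move/eqP; rewrite mulf_eq0 subr_eq0 (negbTE gk).
Qed.

Lemma sum_horner_Fp (f : {poly 'F_l}) : (size f < l)%N -> \sum_t f.[t] = 0.
Proof.
move=> sf; under eq_bigr => t _ do rewrite horner_coef.
rewrite exchange_big big1 // => i _; rewrite -big_distrr /= sum_expr_Fp ?mulr0 //.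
by rewrite ltn_subRL add1n (leq_ltn_trans (ltn_ord i)).
Qed.

End PowerSums.

Section JacobiSum.
Variables (l : nat) (u : 'F_l).
Hypotheses (pl : prime l) (ol : odd l) (u2 : u ^+ 2 = -1).

Definition jlog (t : 'F_l) := qlog u t + qlog u (1 - t).
Definition jre : int := \sum_(t : 'F_l) if t * (1 - t) == 0 then 0 else re4 (jlog t).
Definition jim : int := \sum_(t : 'F_l) if t * (1 - t) == 0 then 0 else im4 (jlog t).

Lemma jacE (K : fieldType) (j : K) : j ^+ 2 = -1 ->
  jac u j 1 = jre%:~R + jim%:~R * j.
Proof.
move=> j2; rewrite /jre /jim !rmorph_sum big_distrl -big_split.
apply: eq_bigr => t _ /=; rewrite /qchar mulf_eq0.
case: eqP => _; first by rewrite !mul0r addr0.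
case: eqP => _; first by rewrite !mulr0 !mul0r addr0.
by rewrite -expi_re_im // !mulr1n expiD.
Qed.

Lemma jac3E (K : fieldType) (j : K) : j ^+ 2 = -1 ->
  jac u j 3 = jre%:~R - jim%:~R * j.
Proof.
move=> j2; rewrite /jre /jim !rmorph_sum big_distrl -sumrB.
apply: eq_bigr => t _ /=; rewrite /qchar mulf_eq0.
case: eqP => _; first by rewrite !mul0r subr0.
case: eqP => _; first by rewrite !mulr0 !mul0r subr0.
rewrite -expiD // -mulrnDl expi_re_im // re4_conj im4_conj rmorphN /=.
by rewrite mulNr.
Qed.

Lemma jim_even : (2 %| jim)%Z.
Proof.
apply: (even_sum_reflect pl ol) => [t|].
  by rewrite /jlog subKr mulrC [qlog u (1 - t) + _]addrC.
case: eqP => // _; rewrite /jlog.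
have -> : 1 - 2^-1 = 2^-1 :> 'F_l; last exact: im4_double.
have two := two_Fp_neq0 pl ol; apply: (mulfI two).
by rewrite mulrBr mulr1 mulfV // mulr2n addrK.
Qed.

(** Multiply the formulas g(chi)^2 = J g(chi^2) for chi and its conjugate
    chi^3 over the complex numbers, where integers can be compared. *)
Lemma jac_norm : jre ^+ 2 + jim ^+ 2 = l%:Z.
Proof.
have l1 := prime_gt1 pl.
have lC : (l%:R : algC) != 0 by rewrite pnatr_eq0 -lt0n ltnW.
have [z zl z1] := closed_unity_root l1 lC.
have i2 : ('i : algC) ^+ 2 = -1 := sqrCi _.
have two : (2 : algC) != 0 by rewrite pnatr_eq0.
have s1 := gauss_sq pl ol u2 zl i2 two (e := 1) isT.
have s3 := gauss_sq pl ol u2 zl i2 two (e := 3) isT.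
have g2 := gauss2_sq pl ol u2 zl z1 i2 two.
have gc := gauss_conj pl ol u2 zl z1 i2 two (e := 1) (e' := 3) isT erefl.
have c1 : qchar u 'i 1 (-1) ^+ 2 = 1 :> algC.
  by rewrite expr2 -qcharD // qchar2_N1.
have : ((jre ^+ 2 + jim ^+ 2)%:~R : algC) = l%:R.
  apply: (mulfI lC); rewrite rmorphD !rmorphXn /=.
  transitivity (jac u 'i 1 * jac u 'i 3 * gauss u z 'i 2 ^+ 2 : algC).
    rewrite g2 jacE // jac3E // mulrC; congr (_ * _).
    rewrite [RHS]mulrC -subr_sqr exprMn i2; ring.
  transitivity (gauss u z 'i 1 ^+ 2 * gauss u z 'i 3 ^+ 2 : algC).
    by rewrite s1 s3; ring.
  by rewrite -exprMn gc exprMn c1 mul1r expr2.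
by move/eqP; rewrite (eqr_int _ _ l%:Z) => /eqP.
Qed.

(** The Jacobi sum vanishes modulo the Gaussian prime that defines u: there
    the quartic character is t^((l-1)/4), and a polynomial of degree
    (l-1)/2 < l - 1 sums to zero over the field. *)
Lemma jac_root : jre%:~R + jim%:~R * u = 0.
Proof.
rewrite -jacE //; have l4 := sqrtN1_mod4 pl ol u2; have l1 := prime_gt1 pl.
pose m := ((l - 1) %/ 4)%N; have m0 : (0 < m)%N by rewrite /m; lia.
have charE t : qchar u u 1 t = t ^+ m.
  rewrite /qchar; case: eqP => [->|/eqP t0]; first by rewrite expr0n gtn_eqF.
  by rewrite mulr1n qlogP.
pose f : {poly 'F_l} := 'X ^+ m * (1 - 'X) ^+ m.
rewrite -[RHS](@sum_horner_Fp l pl f).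
  by apply: eq_bigr => t _; rewrite !charE hornerM !horner_exp !hornerE.
have sX : size (1 - 'X : {poly 'F_l}) = 2.
  by rewrite -opprB size_polyN size_XsubC.
apply: leq_ltn_trans (size_polyMleq _ _) _.
have := size_poly_exp_leq (1 - 'X : {poly 'F_l}) m.
rewrite size_polyXn sX mul1n; set s := size _; move=> sm.
apply: (leq_ltn_trans (n := (m + m.+1)%N)); last by rewrite /m; lia.
by rewrite addSn leq_add2l.
Qed.

End JacobiSum.

Lemma intr_eq0_char (K : fieldType) q (n : int) : q \in [pchar K] ->
  (n%:~R == 0 :> K) = (q %| n)%Z.
Proof. by move=> qK; rewrite (dvdz_pcharf qK). Qed.

Lemma two_char_neq0 (K : fieldType) q : q \in [pchar K] -> odd q -> (2 : K) != 0.
Proof.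
move=> qK oq; have := intr_eq0_char 2 qK; rewrite /= => ->.
rewrite dvdzE /= dvdn_prime2 ?(pcharf_prime qK) //.
by apply: contraTneq oq => ->.
Qed.

Section PrimeReciprocity.
Variables (l : nat) (u : 'F_l).
Hypotheses (pl : prime l) (ol : odd l) (u2 : u ^+ 2 = -1).
Variables (K : closedFieldType) (j : K) (q : nat).
Hypotheses (j2 : j ^+ 2 = -1) (qK : q \in [pchar K]) (oq : odd q) (ql : q != l).

Let A : K := (jre u)%:~R + (jim u)%:~R * j.
Let A' : K := (jre u)%:~R - (jim u)%:~R * j.

(** Reciprocity for the Jacobi sum A.  The Gauss sum g satisfies
    g^4 = A^3 A', and Frobenius gives g^(q-1) or g^(q+1) in terms of the
    character at q, according to q modulo 4.  Frobenius fixes A in the first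
    case and exchanges A and A' in the second. *)
Lemma jac_reciprocity :
  (A / A') ^ quarter (star q) = expi j (qlog u (star q)%:~R).
Proof.
have pq := pcharf_prime qK; have two := two_char_neq0 qK oq.
have AA' : A * A' = l%:R.
  rewrite -[RHS]/((l%:Z)%:~R) -(jac_norm pl ol u2) rmorphD !rmorphXn /= /A /A'.
  transitivity ((jre u)%:~R ^+ 2 - (jim u)%:~R ^+ 2 * j ^+ 2); first by ring.
  by rewrite j2 mulrN1 opprK.
have lK : (l%:R : K) != 0.
  have := intr_eq0_char l qK; rewrite /= => ->.
  by rewrite dvdzE /= dvdn_prime2.
have [A0 A'0] : A != 0 /\ A' != 0.
  by move: lK; rewrite -AA' mulf_eq0 negb_or => /andP[].
have [z zl z1] := closed_unity_root (prime_gt1 pl) lK.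
have s1 := gauss_sq pl ol u2 zl j2 two (e := 1) isT.
have g2 := gauss2_sq pl ol u2 zl z1 j2 two.
have gc := gauss_conj pl ol u2 zl z1 j2 two (e := 1) (e' := 3) isT erefl.
have gf := gauss_frobenius pl ol u2 zl j2 qK ql.
set g := gauss u z j 1 in s1 gc gf.
have g4 : g ^+ 4 = A ^+ 3 * A'.
  by rewrite (exprM g 2 2) s1 exprMn g2 jacE // -/A -AA'; ring.
have g0 : g != 0.
  apply/eqP => g0; move: g4; rewrite g0 expr0n /= => /eqP.
  by rewrite eq_sym mulf_eq0 expf_eq0 /= (negbTE A0) (negbTE A'0).
have q0 : (q%:R : 'F_l) != 0.
  have := intr_Fp_eq0 q pl; rewrite /= => ->.
  by rewrite dvdzE /= dvdn_prime2 // eq_sym.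
have charE t : t != 0 -> qchar u j 1 t = expi j (qlog u t).
  by move=> t0; rewrite /qchar (negbTE t0) mulr1n.
have Aq : A ^+ q = (jre u)%:~R + (jim u)%:~R * j ^+ q.
  rewrite -(pFrobenius_autE qK) rmorphD rmorphM /= !pFrobenius_autE.
  by rewrite -!(pFrobenius_autE qK) !rmorph_int.
have [q4|q4] := odd_mod4 oq.
  have [-> -> qE] := star_1mod4 q4; set m := (q %/ 4)%N in qE *.
  have jq : j ^+ q = j.
    by rewrite {1}qE exprS mulnC exprM expr4_i // expr1n mulr1.
  have A4 : A ^+ (m * 4) = 1.
    by apply: (mulfI A0); rewrite -exprS -qE Aq jq mulr1.
  have g4m : (A ^+ 3 * A') ^+ m = (expi j (qlog u q%:R))^-1.
    apply: (mulfI g0); rewrite -g4 -exprM mulnC -exprS -qE gf.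
    rewrite qchar_mod // q4 charE // /gauss mulrC; congr (_ * _).
    by apply: eq_bigr => t _; rewrite qchar_mod // q4.
  apply: (mulIf (_ : (A ^+ 3 * A') ^+ m != 0)).
    by rewrite expf_neq0 // mulf_neq0 ?expf_neq0.
  rewrite {2}g4m divff ?expi_neq0 // -exprMn -[RHS]A4 mulnC exprM.
  by congr (_ ^+ _); field.
have [-> -> qE] := star_3mod4 q4; set m := (q %/ 4)%N in qE *.
have jq : j ^+ q = - j.
  by rewrite qE exprD mulnC exprM expr4_i // expr1n mul1r exprS j2 mulrN1.
have mE : (4 * m.+1)%N = q.+1 by rewrite [in RHS]qE (mulnC 4) mulSn (addnC 4) -addnS.
have A4 : (A ^+ 4) ^+ m.+1 = l%:R.
  by rewrite -exprM mE exprS Aq jq mulrN -/A' AA'.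
have qE3 e : qchar u j q e = qchar u j 3 e by rewrite qchar_mod // q4.
have g4m : (A ^+ 3 * A') ^+ m.+1 = expi j (qlog u (- q%:R)) * l%:R.
  rewrite -g4 -exprM mE exprS gf -charE ?oppr_eq0 // -mulN1r qcharM //.
  have -> : gauss u z j q = gauss u z j 3.
    by apply: eq_bigr => t _; rewrite qE3.
  rewrite mulrCA gc mulrA; congr (_ * _); rewrite mulrC; congr (_ * _).
  apply: (mulfI (qchar_neq0 u j2 3 q0)); rewrite qE3 divff ?qchar_neq0 //.
  by rewrite -qcharD // qchar4.
rewrite rmorphN /= -exprz_inv -exprnP.
apply: (mulIf lK); rewrite -g4m -A4 invf_div -!exprMn.
by congr (_ ^+ _); field.
Qed.
End PrimeReciprocity.

(** * The quartic symbol modulo a primary Gaussian integer *)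

(** The pair (a, b) is a + b i.  Products are taken after evaluation at a
    square root of -1 in some field, where the ring operations are at hand. *)
Definition gint : Type := int * int.
Definition gnorm (w : gint) : int := w.1 ^+ 2 + w.2 ^+ 2.
Definition gconj (w : gint) : gint := (w.1, - w.2).
(** Reduction: the image of w in a ring where j stands for i. *)
Definition gev (R : nzRingType) (j : R) (w : gint) : R := w.1%:~R + w.2%:~R * j.
(** The condition also says that every prime factor of w has degree one, so
    that i is congruent to a rational integer modulo w. *)
Definition primary (w : gint) : bool := coprimez w.1 w.2 && (2 %| w.2)%Z.
(** The image of i modulo the prime factor of w above l. *)
Definition groot (w : gint) (l : nat) : 'F_l := - w.1%:~R / w.2%:~R.
(** The logarithm of the quartic Jacobi symbol of z modulo w. *)
Definition gsym (z w : gint) : 'Z_4 :=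
  lsum (fun l => qlog (groot w l) (gev (groot w l) z)) `|gnorm w|.
Definition gratio (K : fieldType) (j : K) (w : gint) : K :=
  gev j w / gev j (gconj w).

Lemma gev_real (R : nzRingType) (j : R) n : gev j (n, 0) = n%:~R.
Proof. by rewrite /gev /= mul0r addr0. Qed.

Lemma gev_conj (R : nzRingType) (j : R) w : gev (- j) w = gev j (gconj w).
Proof. by rewrite /gev /= rmorphN mulNr mulrN. Qed.

Lemma gev_norm (K : fieldType) (j : K) w : j ^+ 2 = -1 ->
  gev j w * gev j (gconj w) = (gnorm w)%:~R.
Proof.
move=> j2; rewrite /gev /gnorm /= rmorphD !rmorphXn rmorphN /=.
transitivity ((w.1)%:~R ^+ 2 - (w.2)%:~R ^+ 2 * j ^+ 2); first by ring.
by rewrite j2 mulrN1 opprK.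
Qed.

Lemma gnorm_gt0 w : primary w -> (0 < `|gnorm w|)%N.
Proof.
case: w => a b /andP[/= cop _]; rewrite absz_gt0 /gnorm /=.
apply: contraTneq cop => H.
have [-> ->] : a = 0 /\ b = 0 by split; nia.
by [].
Qed.

Lemma gnorm_abs w : (`|gnorm w|%N : int) = gnorm w.
Proof. by rewrite gez0_abs // addr_ge0 ?sqr_ge0. Qed.

Lemma primary_fst_odd w : primary w -> ~~ (2 %| w.1)%Z.
Proof.
case/andP=> cop b2; apply/negP => a2.
have : (2 %| gcdz w.1 w.2)%Z by rewrite dvdz_gcd a2 b2.
by move: cop; rewrite /coprimez => /eqP ->.
Qed.

Lemma gnorm_mod4 w : primary w -> (gnorm w = 1 %[mod 4])%Z.
Proof.
move=> wP; have := primary_fst_odd wP; case: w wP => a b /andP[_ /= /dvdzP[k ->]] a2.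
have [e ->] : exists e, a = e * 2 + 1 by exists ((a %/ 2)%Z); lia.
have -> : gnorm (e * 2 + 1, k * 2) = (e ^+ 2 + e + k ^+ 2) * 4 + 1.
  by rewrite /gnorm /=; ring.
by rewrite modzMDl.
Qed.

Lemma primary_odd w : primary w -> odd `|gnorm w|.
Proof. move=> wP; have := gnorm_mod4 wP; have := gnorm_abs w; lia. Qed.

Section Place.
Variables (w : gint) (l : nat).
Hypotheses (wP : primary w) (pl : prime l) (lw : (l %| `|gnorm w|)%N).

Lemma place_odd : odd l.
Proof. exact: (dvdn_odd lw (primary_odd wP)). Qed.

Lemma place_snd_neq0 : (w.2%:~R : 'F_l) != 0.
Proof.
case/andP: wP => cop _; apply/eqP => b0.
have l2 : (l %| w.2)%Z by rewrite -intr_Fp_eq0 // b0.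
have : ((gnorm w)%:~R : 'F_l) == 0 by rewrite intr_Fp_eq0 // dvdzE.
rewrite /gnorm rmorphD !rmorphXn /= b0 (expr0n _ 2) addr0 expf_eq0 /= intr_Fp_eq0 // => l1.
have : (l %| gcdz w.1 w.2)%Z by rewrite dvdz_gcd l1 l2.
move: cop; rewrite /coprimez => /eqP ->.
by rewrite dvdzE /= dvdn1 => /eqP l_1; move: pl; rewrite l_1.
Qed.

Lemma place_root : gev (groot w l) w = 0.
Proof. by rewrite /gev /groot mulrC divfK ?place_snd_neq0 // subrr. Qed.

Lemma place_sqr : groot w l ^+ 2 = -1.
Proof.
have b0 := place_snd_neq0; have : ((gnorm w)%:~R : 'F_l) == 0.
  by rewrite intr_Fp_eq0 // dvdzE.
rewrite /gnorm rmorphD !rmorphXn /= => /eqP nz.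
apply: (mulIf (expf_neq0 2 b0)); rewrite -exprMn /groot divfK // sqrrN mulN1r.
by apply/eqP; rewrite -addr_eq0 nz.
Qed.

Lemma place_unique (v : 'F_l) : gev v w = 0 -> v = groot w l.
Proof.
move=> /eqP; rewrite /gev addrC addr_eq0 => /eqP e.
by apply: (mulfI place_snd_neq0); rewrite e /groot mulrC divfK ?place_snd_neq0.
Qed.

Lemma place_conj_neq0 : gev (groot w l) (gconj w) != 0.
Proof.
have := place_root; rewrite /gev /= => /eqP; rewrite addr_eq0 => /eqP ->.
rewrite rmorphN /= mulNr -opprD oppr_eq0 -mulr2n -mulr_natl mulf_neq0 //.
  exact: two_Fp_neq0 place_odd.
by rewrite mulf_neq0 ?place_snd_neq0 // (i_neq0 place_sqr).
Qed.

End Place.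

Lemma gsymM z z1 z2 w : primary w ->
  (forall l, prime l -> (l %| `|gnorm w|)%N ->
    [/\ gev (groot w l) z1 != 0, gev (groot w l) z2 != 0
      & gev (groot w l) z = gev (groot w l) z1 * gev (groot w l) z2]) ->
  gsym z w = gsym z1 w + gsym z2 w.
Proof.
move=> wP H; rewrite -lsumD; apply: eq_lsum => l pl lw.
have [z10 z20 ->] := H l pl lw.
by rewrite qlogM // ?(place_odd wP) ?place_sqr.
Qed.

Lemma dvdz_Fp l (n : int) : prime l -> (n%:~R : 'F_l) = 0 -> exists m, n = m * l%:Z.
Proof. by move=> pl /eqP; rewrite intr_Fp_eq0 // => /dvdzP. Qed.

(** The Jacobi sum rho of the place of w above l divides w: both w and rho
    vanish there, so w conj rho vanishes at both places above l and is
    divisible by l.  The quotient by l is w'. *)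
Lemma primary_factor w l : primary w -> prime l -> (l %| `|gnorm w|)%N ->
  let u := groot w l in
  exists2 w' : gint, primary w' &
    [/\ gnorm w = gnorm w' * l%:Z,
        w.1 = w'.1 * jre u - w'.2 * jim u & w.2 = w'.1 * jim u + w'.2 * jre u].
Proof.
move=> wP pl lw u; have ol := place_odd wP lw.
have u2 : u ^+ 2 = -1 := place_sqr wP pl lw.
have nrho := jac_norm pl ol u2; have rrho := jac_root pl ol u2.
have /dvdzP[f2 f2E] := jim_even u pl ol; have rw : gev u w = 0 := place_root wP pl lw.
have l0 : l%:Z != 0 by have := prime_gt0 pl; lia.
move: nrho rrho f2E; set e := jre u; set f := jim u => nrho rrho f2E.
have {}rw : w.1%:~R = - (w.2%:~R * u) by apply/eqP; rewrite -addr_eq0; apply/eqP.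
have {}rrho : e%:~R = - (f%:~R * u) by apply/eqP; rewrite -addr_eq0; apply/eqP.
have [|a' a'E] := @dvdz_Fp l (w.1 * e + w.2 * f) pl.
  rewrite rmorphD !rmorphM /= rw rrho.
  have -> : - (w.2%:~R * u) * - (f%:~R * u) + w.2%:~R * f%:~R
    = w.2%:~R * f%:~R * (u ^+ 2 + 1) by ring.
  by rewrite u2 addNr mulr0.
have [|b' b'E] := @dvdz_Fp l (w.2 * e - w.1 * f) pl.
  by rewrite rmorphB !rmorphM /= rw rrho; ring.
have aE : w.1 = a' * e - b' * f.
  apply: (mulIf l0); rewrite mulrBl mulrAC -a'E [b' * f * _]mulrAC -b'E -nrho; ring.
have bE : w.2 = a' * f + b' * e.
  apply: (mulIf l0); rewrite mulrDl mulrAC -a'E [b' * e * _]mulrAC -b'E -nrho; ring.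
exists (a', b'); last first.
  split=> //=; apply: (mulIf l0); rewrite -mulrA /gnorm /= mulrDl.
  have -> : (a' ^+ 2 + b' ^+ 2) * (l%:Z * l%:Z) = (a' * l%:Z) ^+ 2 + (b' * l%:Z) ^+ 2 by ring.
  by rewrite -a'E -b'E -nrho; ring.
case/andP: (wP) => /coprimezP[[s t] /= st] /dvdzP[b2 b2E].
apply/andP; split=> /=.
  apply/coprimezP; exists (s * e + t * f, t * e - s * f) => /=.
  by rewrite -st aE bE; ring.
have [e2 e2E] : exists e2, e = e2 * 2 + 1.
  exists (e %/ 2)%Z; have : (e %% 2)%Z != 0; last by lia.
  apply/eqP => /dvdz_mod0P/dvdzP[k ek].
  have lE : l%:Z = (k * k * 2 + f2 * f2 * 2) * 2 by rewrite -nrho ek f2E; ring.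
  by move: ol lE; lia.
apply/dvdzP; exists (b2 - a' * f2 - b' * e2).
have : b' * e = w.2 - a' * f by rewrite bE; ring.
by rewrite b2E e2E f2E => H; rewrite -[LHS]mulr1 -[1](addKr (e2 * 2)) mulrDr H; ring.
Qed.

(** Both sides are multiplicative in w, and w = 1 or -1 is trivial, so it is
    enough to split off the Jacobi sum above one prime factor l of the norm. *)
Theorem quartic_reciprocity (K : closedFieldType) (j : K) q w :
  q \in [pchar K] -> odd q -> j ^+ 2 = -1 -> primary w -> ~~ (q %| `|gnorm w|)%N ->
  gratio j w ^ quarter (star q) = expi j (gsym (star q, 0) w).
Proof.
move=> qK oq j2; have [n] := ubnP `|gnorm w|%N; elim: n w => // n IHn w nw wP qw.
have [w1|w1] := leqP `|gnorm w|%N 1%N.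
  have {}w1 : `|gnorm w|%N = 1%N by have := gnorm_gt0 wP; lia.
  have b0 : w.2 = 0.
    case/andP: wP => _ /dvdzP[k bE]; have := gnorm_abs w.
    rewrite w1 /gnorm bE => H; have [->|k0] := eqVneq k 0; first by rewrite mul0r.
    have : 1 <= k ^+ 2 by rewrite -gtz0_ge1 exprn_even_gt0.
    have : 0 <= w.1 ^+ 2 by exact: sqr_ge0.
    move: H; rewrite exprMn; lia.
  rewrite /gratio /gconj {1}[w]surjective_pairing b0 oppr0 divff ?exp1rz.
    by rewrite /gsym w1 lsum1 expi0.
  have := gev_norm w j2; rewrite -gnorm_abs w1 /gconj /gev b0 oppr0 mul0r addr0 /= => /eqP.
  by apply: contraTneq => ->; rewrite mul0r eq_sym oner_eq0.
have pl := pdiv_prime w1; set l := pdiv _ in pl.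
have lw : (l %| `|gnorm w|)%N := pdiv_dvd _.
have ol := place_odd wP lw; have [w' w'P [nE aE bE]] := primary_factor wP pl lw.
have u2 := place_sqr wP pl lw.
move: aE bE; set u := groot w l in u2 *; set e := jre u; set f := jim u => aE bE.
have nE' : `|gnorm w|%N = (`|gnorm w'| * l)%N by rewrite nE abszM.
have ql : q != l by apply: contraNneq qw => ->.
have qw' : ~~ (q %| `|gnorm w'|)%N by apply: contra qw => qw'; rewrite nE' dvdn_mulr.
have -> : gsym (star q, 0) w = gsym (star q, 0) w' + qlog u (star q)%:~R.
  rewrite [in LHS]/gsym nE' lsumM ?gnorm_gt0 ?prime_gt0 // (lsum_prime _ pl) gev_real.
  rewrite -/u; move: (qlog u _) => k; suff -> : gsym (star q, 0) w' = lsum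
    (fun l => qlog (groot w l) (gev (groot w l) (star q, 0))) `|gnorm w'| by [].
  apply: eq_lsum => l' pl' lw'; rewrite !gev_real; suff -> : groot w' l' = groot w l' by [].
  apply: place_unique => //; first by rewrite nE' dvdn_mulr.
  have := place_root w'P pl' lw'; set v := groot w' l' => rv.
  have v2 : v ^+ 2 = -1 := place_sqr w'P pl' lw'.
  rewrite /gev aE bE rmorphB rmorphD !rmorphM /=.
  transitivity (gev v w' * (e%:~R + f%:~R * v) - w'.2%:~R * f%:~R * (v ^+ 2 + 1)).
    by rewrite /gev; ring.
  by rewrite rv v2 addNr mul0r mulr0 subrr.
have evE (i : K) : i ^+ 2 = -1 -> gev i w = gev i w' * (e%:~R + f%:~R * i).
  move=> i2; rewrite /gev aE bE rmorphB rmorphD !rmorphM /=.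
  transitivity (gev i w' * (e%:~R + f%:~R * i) - w'.2%:~R * f%:~R * (i ^+ 2 + 1)).
    by rewrite /gev; ring.
  by rewrite i2 addNr mulr0 subr0.
have -> : gratio j w = gratio j w' * ((e%:~R + f%:~R * j) / (e%:~R - f%:~R * j)).
  by rewrite /gratio -!gev_conj !evE ?sqrrN // invfM mulrN mulrACA.
rewrite expfzMl expiD // -(jac_reciprocity pl ol u2 j2 qK oq ql) IHn //.
move: nw; rewrite nE'; have := prime_gt1 pl; have := gnorm_gt0 w'P.
move: `|gnorm w'|%N l {pl lw ol u2 aE bE u e f ql nE nE' evE} => N l'; clear; nia.
Qed.

(** * Evaluating symbols with rational numerators *)

(** An algebraically closed field of characteristic q contains all the roots
    of unity needed above, for all primes l at once. *)
Lemma closed_pchar q : prime q ->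
  {K : closedFieldType & {rmorphism 'F_q -> K}}.
Proof.
move=> pq; have [K [f _]] := countable_algebraic_closure 'F_q.
by exists K.
Qed.

Lemma rmorph_pchar q (K : fieldType) (f : {rmorphism 'F_q -> K}) :
  prime q -> q \in [pchar K].
Proof.
by move=> pq; rewrite inE /= pq -(rmorph_nat f) pchar_Fp_0 // rmorph0 eqxx.
Qed.

Lemma coprimez_prime_dvd l (m n : int) : prime l -> coprimez m n -> (l %| m)%Z -> (l %| n)%Z -> False.
Proof.
move=> pl cop lm ln; have : (l %| gcdz m n)%Z by rewrite dvdz_gcd lm ln.
by move: cop; rewrite /coprimez => /eqP ->; rewrite dvdz1 /= => /eqP l1; move: pl; rewrite l1.
Qed.

Lemma coprimez_places n w : primary w ->
  (forall l, prime l -> (l %| `|gnorm w|)%N -> (n%:~R : 'F_l) != 0) ->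
  coprimez n (gnorm w).
Proof.
move=> wP H; rewrite coprimezE /coprime; apply: contraT => g1.
have g0 : (0 < gcdn `|n| `|gnorm w|)%N by rewrite gcdn_gt0 gnorm_gt0 // orbT.
have pl : prime (pdiv (gcdn `|n| `|gnorm w|)) by rewrite pdiv_prime // ltn_neqAle eq_sym g1.
have [ln lw] : (pdiv (gcdn `|n| `|gnorm w|) %| `|n|)%N /\ (pdiv (gcdn `|n| `|gnorm w|) %| `|gnorm w|)%N.
  by split; apply: dvdn_trans (pdiv_dvd _) _; rewrite ?dvdn_gcdl ?dvdn_gcdr.
by have := H _ pl lw; rewrite intr_Fp_eq0 // dvdzE ln.
Qed.

Lemma gev_coprime_neq0 (K : fieldType) (j : K) q n w :
  q \in [pchar K] -> j ^+ 2 = -1 -> (q %| n)%Z -> coprimez n (gnorm w) ->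
  gev j w != 0 /\ gev j (gconj w) != 0.
Proof.
move=> qK j2 qn cop; apply/andP; rewrite -negb_or -mulf_eq0 gev_norm //.
by apply/negP; rewrite (intr_eq0_char _ qK) => /(coprimez_prime_dvd (pcharf_prime qK) cop qn).
Qed.

Lemma gsym_star n w : primary w -> (n = 1 %[mod 4])%Z -> coprimez n (gnorm w) ->
  gsym (n, 0) w = lsum (fun q => gsym (star q, 0) w) `|n|%N.
Proof.
move=> wP; apply: (additive_star (h := fun n => gsym (n, 0) w)
  (S := fun n => coprimez n (gnorm w))) => [|m k|m k cm ck _ _].
- rewrite /gsym -[RHS](lsumMn (fun=> 0) 0 `|gnorm w|); apply: eq_lsum => l _ _.
  by rewrite gev_real qlog1.
- by rewrite coprimezMl => /andP[].
have ne z l : prime l -> (l %| `|gnorm w|)%N -> coprimez z (gnorm w) ->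
    gev (groot w l) (z, 0) != 0.
  move=> pl lw; rewrite gev_real intr_Fp_eq0 //; apply: contraL => lz.
  apply/negP => /eqP cz; have : (l %| gcdz z (gnorm w))%Z by rewrite dvdz_gcd lz dvdzE.
  by rewrite cz dvdz1 /= => /eqP l1; move: pl; rewrite l1.
by apply: gsymM => // l pl lw; rewrite !ne // !gev_real rmorphM.
Qed.

(** A multiplicative relation between the ratios w / conj w modulo all the
    primes dividing n gives, after raising to the power quarter (star q), an
    additive relation between the symbols of n. *)
Lemma gsym_relation n (ws : seq (gint * int)) (e : int) :
  (n = 1 %[mod 4])%Z ->
  {in ws, forall w, primary w.1 /\ coprimez n (gnorm w.1)} ->
  (forall q (K : closedFieldType) (j : K), q \in [pchar K] -> odd q ->
     (q %| n)%Z -> j ^+ 2 = -1 -> \prod_(w <- ws) gratio j w.1 ^ w.2 = j ^ e) ->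
  \sum_(w <- ws) gsym (n, 0) w.1 *~ w.2 = (quarter n)%:~R *~ e.
Proof.
move=> n4 wsP H.
have on : odd `|n|%N by clear -n4; lia.
have lsumMz f (z : int) : lsum (fun q => f q *~ z) `|n| = lsum f `|n| *~ z.
  case: z => k; first exact: lsumMn.
  rewrite NegzE mulrNz -pmulrn -lsumMn -lsumN; apply: eq_lsum => l _ _.
  by rewrite mulrNz.
transitivity (lsum (fun q => \sum_(w <- ws) gsym (star q, 0) w.1 *~ w.2) `|n|).
  rewrite /lsum; under [RHS]eq_bigr do rewrite -sumrMnl.
  rewrite exchange_big; apply: eq_big_seq => w /wsP[wP wn].
  by rewrite gsym_star // -lsumMz.
rewrite quarter_star // -lsumMz; apply: eq_lsum => q pq qn.
have oq : odd q := dvdn_odd qn on.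
have [K f] := closed_pchar pq; have qK := rmorph_pchar f pq.
have [j j2] := closed_sqrtN1 K.
apply: (expi_inj j2 (two_char_neq0 qK oq)).
rewrite expiMz // expi_int // exprz_exp mulrC -exprz_exp -(H q K j) //.
rewrite (big_morph (fun x : K => x ^ quarter (star q)) (id1 := 1) (op1 := *%R)); last first.
- by rewrite exp1rz.
- by move=> a b; rewrite expfzMl.
rewrite (big_morph (expi j) (expiD j2) (expi0 j)); apply: eq_big_seq => w /wsP[wP wn].
rewrite expiMz // -quartic_reciprocity //; first by rewrite !exprz_exp mulrC.
apply/negP => qw; move: wn; rewrite coprimezE => cn.
have : (q %| gcdn `|n| `|gnorm w.1|)%N by rewrite dvdn_gcd qn.
by rewrite (eqP cn) dvdn1 => /eqP q1; rewrite q1 in pq.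
Qed.

(** When q = l is congruent to 1 modulo 4, reciprocity takes place in the
    prime field itself and its right-hand side is again a quartic symbol. *)
Lemma gsym_split l (u : 'F_l) w : prime l -> odd l -> u ^+ 2 = -1 -> primary w ->
  ~~ (l %| `|gnorm w|)%N -> gsym (l%:Z, 0) w = qlog u (gratio u w).
Proof.
move=> pl ol u2 wP lw; have l4 := sqrtN1_mod4 pl ol u2.
have [K f] := closed_pchar pl; have qK := rmorph_pchar f pl.
have j2 : f u ^+ 2 = -1 by rewrite -rmorphXn u2 rmorphN1.
have := quartic_reciprocity qK ol j2 wP lw.
have -> : star l = l by rewrite /star l4.
have -> : quarter l = ((l - 1) %/ 4)%N by rewrite /quarter; have := prime_gt1 pl; lia.
have gevE z : gev (f u) z = f (gev u z) by rewrite /gev rmorphD rmorphM !rmorph_int.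
rewrite -exprnP /gratio !gevE -fmorph_div -rmorphXn /expi -rmorphXn => /fmorph_inj H.
symmetry; apply: (qlog_unique pl ol u2) => //.
have nz : gev u w * gev u (gconj w) != 0.
  by rewrite gev_norm // intr_Fp_eq0 // dvdzE.
by rewrite mulf_eq0 invr_eq0 -mulf_eq0.
Qed.

(** The symbol of i at a prime l is (l - 1)/4, and quarter is additive
    modulo 4. *)
Lemma gsym_i w : primary w -> gsym (0, 1) w = (quarter (gnorm w))%:~R.
Proof.
move=> wP; rewrite (quarter_star (gnorm_mod4 wP)); apply: eq_lsum => l pl lw.
have ol := place_odd wP lw; have v2 := place_sqr wP pl lw.
have l4 := sqrtN1_mod4 pl ol v2; rewrite /gev /= add0r mul1r qlog_i //.
rewrite /star l4 /= pmulrn; congr (_%:~R); rewrite /quarter.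
by have := prime_gt1 pl; lia.
Qed.

(** From 2 = - i (1 + i)^2. *)
Lemma qlog_two l (u : 'F_l) : prime l -> odd l -> u ^+ 2 = -1 ->
  1 + u != 0 /\ qlog u 2 = qlog u u *+ 3 + qlog u (1 + u) *+ 2.
Proof.
move=> pl ol u2; have two := two_Fp_neq0 pl ol.
have twoE : (2 : 'F_l) = u ^+ 3 * (1 + u) ^+ 2.
  transitivity (u ^+ 2 * u * (1 + u ^+ 2 + 2 * u)); last by ring.
  by rewrite u2 subrr add0r mulN1r mulNr mulrCA -expr2 u2 mulrN1 opprK.
have u1 : 1 + u != 0.
  by apply: contra_neq two => u1; rewrite twoE u1 expr0n mulr0.
by split=> //; rewrite {1}twoE qlogM ?qlogX ?expf_neq0 ?(i_neq0 u2).
Qed.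

Lemma mulrn4_Z4 (z : 'Z_4) : z *+ 4 = 0.
Proof. by rewrite -mulr_natr (_ : 4%:R = 0) ?mulr0 //; apply/val_inj. Qed.

Lemma qlog_four l (u : 'F_l) : prime l -> odd l -> u ^+ 2 = -1 ->
  qlog u 2 *+ 2 = qlog u u *+ 2.
Proof.
move=> pl ol u2; have [_ ->] := qlog_two pl ol u2.
rewrite mulrnDl -!mulrnA (_ : (3 * 2 = 2 + 4)%N) // mulrnDr.
by rewrite (mulrn4_Z4 (qlog u u)) (mulrn4_Z4 (qlog u (1 + u))) 2!addr0.
Qed.

Lemma qlog_relation l (u a b e f g : 'F_l) t : prime l -> odd l -> u ^+ 2 = -1 ->
  [/\ a != 0, b != 0, e != 0, f != 0 & g != 0] ->
  a * b * 2 ^+ (2 * t) * e ^+ 2 = f * g * u ->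
  qlog u a + qlog u b + qlog u u *+ (2 * t) + qlog u e *+ 2
  = qlog u f + qlog u g + qlog u u.
Proof.
move=> pl ol u2 [a0 b0 e0 f0 g0] H; have two := two_Fp_neq0 pl ol.
have u0 := i_neq0 u2.
have ab0 := mulf_neq0 a0 b0; have t0 := expf_neq0 (2 * t) two; have e20 := expf_neq0 2 e0.
have qM := @qlogM l u pl ol u2; have qX := @qlogX l u pl ol u2.
rewrite -(qM _ _ f0 g0) -(qM _ _ (mulf_neq0 f0 g0) u0) -H.
rewrite (qM _ _ (mulf_neq0 ab0 t0) e20) (qM _ _ ab0 t0) (qM _ _ a0 b0) (qX _ _ two) (qX _ _ e0).
by rewrite !(mulrnA _ 2 t) (qlog_four pl ol u2).
Qed.

Lemma gsym_ratio_mul n w w1 w2 : (n = 1 %[mod 4])%Z ->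
  primary w -> coprimez n (gnorm w) -> primary w1 -> coprimez n (gnorm w1) ->
  primary w2 -> coprimez n (gnorm w2) ->
  (forall q (K : closedFieldType) (j : K), q \in [pchar K] -> odd q ->
     (q %| n)%Z -> j ^+ 2 = -1 -> gratio j w = gratio j w1 * gratio j w2 * j) ->
  gsym (n, 0) w = gsym (n, 0) w1 + gsym (n, 0) w2 + (quarter n)%:~R.
Proof.
move=> n4 wP cw w1P cw1 w2P cw2 H.
have := @gsym_relation n [:: (w, 1); (w1, -1); (w2, -1)] 1 n4 _ _.
rewrite 2!big_cons big_seq1; cbn [fst snd]; rewrite !mulrNz !mulr1z => <-.
    by move: (gsym _ w) (gsym _ w1) (gsym _ w2) => *; ring.
  by move=> z; rewrite !inE => /or3P[] /eqP ->.
move=> q K j qK oq qn j2; rewrite 2!big_cons big_seq1; cbn [fst snd]; rewrite !exprN1 !expr1z (H q) //.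
have [a1 b1] := gev_coprime_neq0 qK j2 qn cw1.
have [a2 b2] := gev_coprime_neq0 qK j2 qn cw2.
by rewrite /gratio; field; rewrite a1 b1 a2 b2.
Qed.

Lemma gsym_ratio_inv n w w1 : (n = 1 %[mod 4])%Z ->
  primary w -> coprimez n (gnorm w) -> primary w1 -> coprimez n (gnorm w1) ->
  (forall q (K : closedFieldType) (j : K), q \in [pchar K] -> odd q ->
     (q %| n)%Z -> j ^+ 2 = -1 -> gratio j w * gratio j w1 = j^-1) ->
  gsym (n, 0) w + gsym (n, 0) w1 = - (quarter n)%:~R.
Proof.
move=> n4 wP cw w1P cw1 H.
have := @gsym_relation n [:: (w, 1); (w1, 1)] (-1) n4 _ _.
rewrite big_cons big_seq1; cbn [fst snd]; rewrite !mulrNz !mulr1z; apply.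
  by move=> z; rewrite !inE => /orP[] /eqP ->.
move=> q K j qK oq qn j2; rewrite big_cons big_seq1; cbn [fst snd]; rewrite !expr1z exprN1.
exact: (H q).
Qed.

Lemma gsym_ratio_sq n w w1 : (n = 1 %[mod 4])%Z ->
  primary w -> coprimez n (gnorm w) -> primary w1 -> coprimez n (gnorm w1) ->
  (forall q (K : closedFieldType) (j : K), q \in [pchar K] -> odd q ->
     (q %| n)%Z -> j ^+ 2 = -1 -> gratio j w = gratio j w1 ^+ 2) ->
  gsym (n, 0) w = gsym (n, 0) w1 *+ 2.
Proof.
move=> n4 wP cw w1P cw1 H.
have := @gsym_relation n [:: (w, 1); (w1, - 2%:Z)] 0 n4 _ _.
rewrite big_cons big_seq1; cbn [fst snd]; rewrite mulrNz mulr1z mulr0z -pmulrn.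
move=> H0; apply/subr0_eq/H0.
  by move=> z; rewrite !inE => /orP[] /eqP ->.
move=> q K j qK oq qn j2; rewrite big_cons big_seq1; cbn [fst snd]; rewrite expr1z expr0z (H q) //.
have [a1 b1] := gev_coprime_neq0 qK j2 qn cw1.
by rewrite -invr_expz -exprnP divff // expf_neq0 // /gratio mulf_neq0 ?invr_eq0.
Qed.

Lemma gsym_ratio_i n w e : (n = 1 %[mod 4])%Z ->
  primary w -> coprimez n (gnorm w) ->
  (forall q (K : closedFieldType) (j : K), q \in [pchar K] -> odd q ->
     (q %| n)%Z -> j ^+ 2 = -1 -> gratio j w = j ^+ e) ->
  gsym (n, 0) w = (quarter n)%:~R *+ e.
Proof.
move=> n4 wP cw H.
have := @gsym_relation n [:: (w, 1)] e n4 _ _.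
rewrite big_seq1; cbn [fst snd]; rewrite mulr1z -pmulrn; apply.
  by move=> z; rewrite !inE => /eqP ->.
move=> q K j qK oq qn j2; rewrite big_seq1; cbn [fst snd]; rewrite expr1z (H q) //.
Qed.

(** * The exponents of the explicit symbols *)
Lemma Z4_four (k : 'Z_4) : 4 * k = 0.
Proof. by rewrite mulr_natl mulrn4_Z4. Qed.

Lemma eq_cast_Z4 (m n k : int) : m = n + 4 * k -> m%:~R = n%:~R :> 'Z_4.
Proof. by move=> ->; rewrite rmorphD rmorphM /= Z4_four addr0. Qed.

Lemma two_sqr_Z4 (z : 'Z_4) : 2 * z ^+ 2 - 2 * z = 0.
Proof. by case: z => [[|[|[|[|z]]]] lt_z] //; apply/val_inj. Qed.

(** The bookkeeping of all the explicit symbols.  Here n is [i/nu], L is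
    [(1+i)/pi], m is (p-1)/8 and t the exponent of 2 in y.  The hypotheses
    are the equality of the two representations of p, and the fact that the
    half h of y is odd for t = 1 and even for t > 1.  The identity holds up to
    multiples of 4, of 2 z^2 - 2 z, and of the differences of the two sides of
    the hypotheses. *)
Lemma exponent_identity (g d x h b t : 'Z_4) :
  2 * g ^+ 2 + g + 2 * d ^+ 2 = 2 * x ^+ 2 + x + 5 * h ^+ 2 ->
  2 * t * h = 2 * h ->
  let n := (g + x - d) ^+ 2 + (g + x - d) + (d + g - x) ^+ 2 in
  let L := 3 * (g + d) - 2 * g in
  let m := 2 * g ^+ 2 + g + 2 * d ^+ 2 in
  2 * t * n - x + (b + g) + (2 * b ^+ 2 + b) - n - t * (6 * m + 2 * L) - L + m
  = 2 * (d + h).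
Proof.
move=> H T n L m; pose S (z : 'Z_4) := 2 * z ^+ 2 - 2 * z.
have S0 z : S z = 0 := two_sqr_Z4 z.
apply/eqP; rewrite -subr_eq0; apply/eqP.
transitivity (t * (S (g + x - d) + S (d + g - x) - 5 * S h
    - 2 * (2 * g ^+ 2 + g + 2 * d ^+ 2 - (2 * x ^+ 2 + x + 5 * h ^+ 2)))
  - 5 * (2 * t * h - 2 * h) + S b - S (x - d) + S d
  + 4 * (t * (- 2 * g ^+ 2 - 2 * d ^+ 2 - x ^+ 2 - 2 * d) + b - x - 3 * h)).
  by rewrite /n /L /m /S; ring.
by rewrite H T !S0 Z4_four !subrr !mulr0 !addr0 !subr0 mulr0.
Qed.
(** * The auxiliary Gaussian integer *)

(** The computation modulo a prime factor of nu, stated for elements of a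
    field: P is p, Y is 10 y^2 and v is i.  Multiplying 2 nu = 0 by 1 + b v
    gives 2 T X + A = - 2 B v with A + 2 B v = (1 + b v)^2 (C + D v); squaring
    and using A^2 + 4 B^2 = 4 T^2 P yields the relation.  The hypothesis that
    the conjugate of nu does not vanish excludes Y = 0, because P = X^2 would
    make nu and its conjugate proportional. *)
Lemma place_algebra (F : fieldType) (v X C D b T B P Y : F) :
  (2 : F) != 0 -> v ^+ 2 = -1 -> 2 * T = 1 + b ^+ 2 ->
  2 * B = (1 - b ^+ 2) * D + 2 * b * C ->
  P = C ^+ 2 + D ^+ 2 -> P = X ^+ 2 + Y ->
  (1 - b * v) * X + (1 + b * v) * (C + D * v) = 0 ->
  (1 + b * v) * X + (1 - b * v) * (C - D * v) != 0 ->
  (X = 0 -> T = 0 \/ P = 0 -> False) -> (T = 0 -> P = 0 -> False) ->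
  [/\ X != 0, T != 0, Y != 0, B != 0 & T * Y = 2 * X * B * v].
Proof.
move=> two v2 TE BE PE YE r0 r1 HX HT.
have SSc : (1 + b * v) * (1 - b * v) = 2 * T.
  by rewrite TE; transitivity (1 - b ^+ 2 * v ^+ 2); [ring | rewrite v2; ring].
have PPc : (C + D * v) * (C - D * v) = P.
  by rewrite PE; transitivity (C ^+ 2 - D ^+ 2 * v ^+ 2); [ring | rewrite v2; ring].
have X0 : X != 0.
  apply/eqP => X0; apply: HX => //; move/eqP: r0; rewrite X0 mulr0 add0r mulf_eq0.
  case/orP=> /eqP Z; [left | right]; last by rewrite -PPc Z mul0r.
  by apply: (mulfI two); rewrite -SSc Z mul0r mulr0.
have T0 : T != 0.
  apply/eqP => T0; have /eqP := SSc; rewrite T0 mulr0 mulf_eq0 => /orP[/eqP Z|/eqP Z].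
    have : 2 * X = (1 + b * v) * (X - (C + D * v)) +
        ((1 - b * v) * X + (1 + b * v) * (C + D * v)) by ring.
    by rewrite r0 Z mul0r addr0 => /eqP; rewrite mulf_eq0 (negbTE two) (negbTE X0).
  have : 2 * (C + D * v) = (1 - b * v) * (C + D * v - X) +
      ((1 - b * v) * X + (1 + b * v) * (C + D * v)) by ring.
  rewrite r0 Z mul0r addr0 => /eqP; rewrite mulf_eq0 (negbTE two) /= => /eqP Pi0.
  by apply: HT => //; rewrite -PPc Pi0 mul0r.
have rel : T * Y = 2 * X * B * v.
  have h : 2 * T * X + ((1 - b ^+ 2) * C - 2 * b * D) = - (2 * B * v).
    apply/eqP; rewrite -subr_eq0 opprK BE -SSc.
    apply/eqP; transitivity ((1 + b * v) * ((1 - b * v) * X + (1 + b * v) * (C + D * v))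
       - (b ^+ 2 * C + b ^+ 2 * D * v + 2 * b * D) * (v ^+ 2 + 1)); first by ring.
    by rewrite r0 v2 addNr !mulr0 subr0.
  have norm : ((1 - b ^+ 2) * C - 2 * b * D) ^+ 2 + (2 * B) ^+ 2 = (2 * T) ^+ 2 * P.
    by rewrite BE TE PE; ring.
  set A := (1 - b ^+ 2) * C - 2 * b * D in h norm.
  have sq : (2 * T * X + A) ^+ 2 = A ^+ 2 - (2 * T) ^+ 2 * P.
    by rewrite h -norm; transitivity ((2 * B) ^+ 2 * v ^+ 2); [ring | rewrite v2; ring].
  have XA : X * A = - (T * (P + X ^+ 2)).
    apply: (mulfI (_ : 4 * T != 0)).
      by rewrite mulf_neq0 // (_ : 4 = 2 * 2 :> F) ?mulf_neq0 //; ring.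
    apply/eqP; rewrite -subr_eq0; apply/eqP.
    transitivity ((2 * T * X + A) ^+ 2 - (A ^+ 2 - (2 * T) ^+ 2 * P)); first by ring.
    by rewrite sq subrr.
  have -> : 2 * X * B * v = - X * (2 * T * X + A) by rewrite h; ring.
  transitivity (- (2 * T * X ^+ 2) - X * A); last by ring.
  by rewrite XA YE; ring.
have Y0 : Y != 0.
  apply: contraNneq r1 => Y0; rewrite Y0 addr0 in YE.
  have : X * ((1 + b * v) * X + (1 - b * v) * (C - D * v)) == 0.
    apply/eqP.
    transitivity (((1 - b * v) * X + (1 + b * v) * (C + D * v)) * (C - D * v) +
      (1 + b * v) * (X ^+ 2 - (C + D * v) * (C - D * v))); first by ring.
    by rewrite r0 PPc YE subrr mulr0 mul0r addr0.
  by rewrite mulf_eq0 (negbTE X0).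
split=> //; apply/eqP => B0; move: (mulf_neq0 T0 Y0).
by rewrite rel B0 mulr0 mul0r eqxx.
Qed.

Lemma prime_nonsquare p (x : int) : prime p -> p%:Z = x ^+ 2 -> False.
Proof.
move=> pp /(congr1 absz); rewrite abszX /= => pE.
have : (`|x| %| p)%N by rewrite pE dvdn_exp.
case/(primeP pp).2/orP => /eqP xE; move: pE; rewrite xE => pE.
  by move: pp; rewrite pE.
have : (p ^ 1 < p ^ 2)%N by rewrite ltn_exp2l ?prime_gt1.
by rewrite -pE expn1 ltnn.
Qed.

Section AuxiliaryInteger.
(* Here c = 4 ga + 1, d = 4 de, x = 4 xi + 1, y = 2 eta: the congruences of the
   theorem, with the sign of x normalised. *)
Variables (p : nat) (ga de xi eta be : int).
Hypotheses (pp : prime p).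
Let c : int := 4 * ga + 1.
Let d : int := 4 * de.
Let x : int := 4 * xi + 1.
Let y : int := 2 * eta.
Let b : int := 4 * be + 1.
Hypotheses (p_cd : p%:Z = c ^+ 2 + d ^+ 2) (p_xy : p%:Z = x ^+ 2 + 10 * y ^+ 2).

(* prm is pi; s0 is s / (1 + i), where s = 1 + b i; nu is half of
   conj s x + s pi; T0 is (1 + b^2)/2; and 2 B is the imaginary part of
   s^2 pi. *)
Let prm : gint := (c, d).
Let s0 : gint := (2 * be + 1, 2 * be).
Let nu : gint := (2 * ga + 2 * xi + 1 - b * (2 * de), 2 * de + b * (2 * (ga - xi))).
Let T0 : int := gnorm s0.
Let B : int := 2 * de * (1 - b ^+ 2) + b * c.

Hypotheses (cop_nu : coprimez nu.1 nu.2).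
Hypotheses (cop_Tx : coprimez T0 x) (cop_Tp : coprimez T0 p).

Lemma nu_primary : primary nu.
Proof.
rewrite /primary cop_nu /=; apply/dvdzP; exists (de + b * (ga - xi)); ring.
Qed.

Lemma s0_primary : primary s0.
Proof.
apply/andP; split; last by apply/dvdzP; exists be; rewrite /=; ring.
by apply/coprimezP; exists (1, -1) => /=; ring.
Qed.

Lemma gnorm_prm : gnorm prm = p. Proof. by rewrite /gnorm /= p_cd. Qed.

Lemma absz_gnorm_prm : `|gnorm prm|%N = p. Proof. by rewrite gnorm_prm. Qed.

Lemma prm_primary : primary prm.
Proof.
apply/andP; split; last by apply/dvdzP; exists (2 * de); rewrite /= /d; ring.
apply: contraT => /= ncop; pose g := gcdz c d.
have /dvdzP[c' cE] : (g %| c)%Z := dvdz_gcdl _ _.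
have /dvdzP[d' dE] : (g %| d)%Z := dvdz_gcdr _ _.
have pg : (`|g| ^ 2 %| p)%N.
  rewrite -abszX -[p]/(`|p%:Z|%N) -dvdzE p_cd cE dE.
  by apply/dvdzP; exists (c' ^+ 2 + d' ^+ 2); ring.
have g1 : `|g|%N != 1%N by move: ncop; rewrite /coprimez -/g -[g]gez0_abs.
have /(primeP pp).2/orP[|] : (`|g| %| p)%N by exact: dvdn_trans (dvdn_exp _ (dvdnn _)) pg.
  by rewrite (negbTE g1).
move/eqP => gp; move: pg; rewrite gp => /(dvdn_leq (prime_gt0 pp)).
by rewrite leqNgt -{1}[p]expn1 ltn_exp2l ?prime_gt1.
Qed.

Lemma double_nu (K : fieldType) (j : K) : j ^+ 2 = -1 ->
  2 * gev j nu = (1 - b%:~R * j) * x%:~R + (1 + b%:~R * j) * gev j prm.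
Proof.
move=> j2; rewrite /gev /nu /prm /= -[in LHS](subr0 (2 * de)).
apply/eqP; rewrite -subr_eq0; apply/eqP.
transitivity (- b%:~R * d%:~R * (j ^+ 2 + 1) : K).
  by rewrite /b /c /d /x !rmorphB !rmorphD !rmorphM /= !rmorphB /=; ring.
by rewrite j2 addNr mulr0.
Qed.

Lemma double_nu_conj (K : fieldType) (j : K) : j ^+ 2 = -1 ->
  2 * gev j (gconj nu) = (1 + b%:~R * j) * x%:~R + (1 - b%:~R * j) * gev j (gconj prm).
Proof.
move=> j2; have Nj2 : (- j) ^+ 2 = -1 by rewrite sqrrN.
by have := double_nu Nj2; rewrite !gev_conj !mulrN opprK.
Qed.

Lemma one_plus_i_s0 (K : fieldType) (j : K) : j ^+ 2 = -1 ->
  (1 + j) * gev j s0 = 1 + b%:~R * j.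
Proof.
move=> j2; rewrite /gev /s0 /b /= !rmorphD !rmorphM /=.
transitivity (1 + (4 * be%:~R + 1) * j + 2 * be%:~R * (j ^+ 2 + 1)); first by ring.
by rewrite j2 addNr mulr0 addr0.
Qed.

Lemma one_minus_i_s0 (K : fieldType) (j : K) : j ^+ 2 = -1 ->
  (1 - j) * gev j (gconj s0) = 1 - b%:~R * j.
Proof.
move=> j2; have Nj2 : (- j) ^+ 2 = -1 by rewrite sqrrN.
by have := one_plus_i_s0 Nj2; rewrite !gev_conj !mulrN.
Qed.

Lemma T0E : 2 * T0 = 1 + b ^+ 2.
Proof. by rewrite /T0 /gnorm /s0 /b /=; ring. Qed.

Lemma coprime_xp : coprimez x p.
Proof.
rewrite coprimezE coprime_sym prime_coprime //; apply/negP => px.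
have y0 : y != 0.
  apply/eqP => y0; apply: (@prime_nonsquare p x) => //.
  by rewrite p_xy y0 expr0n mulr0 addr0.
have x0 : x != 0 by rewrite /x; lia.
have : (p <= `|x|)%N by rewrite dvdn_leq // absz_gt0.
have : 0 < y ^+ 2 by rewrite exprn_even_gt0.
have : (`|x|%N : int) ^+ 2 = x ^+ 2 by rewrite abszE real_normK // num_real.
have : (0 < `|x|)%N by rewrite absz_gt0.
move: p_xy; move: (`|x|%N) (x ^+ 2) (y ^+ 2) => n X Y; clear; nia.
Qed.

Section AtPlace.
Variable l : nat.
Hypotheses (pl : prime l) (lnu : (l %| `|gnorm nu|)%N).
Let v := groot nu l.

Lemma place_nu : [/\ (x%:~R : 'F_l) != 0, (T0%:~R : 'F_l) != 0,
  (10 * y ^+ 2)%:~R != 0 :> 'F_l, (B%:~R : 'F_l) != 0 &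
  (10 * T0 * y ^+ 2)%:~R = 2 * x%:~R * B%:~R * v].
Proof.
have nuP := nu_primary; have ol := place_odd nuP lnu; have two := two_Fp_neq0 pl ol.
have v2 : v ^+ 2 = -1 := place_sqr nuP pl lnu.
have dvd0 (n : int) : n%:~R = 0 :> 'F_l -> (l %| n)%Z.
  by move=> /eqP; rewrite intr_Fp_eq0.
have -> : (10 * T0 * y ^+ 2)%:~R = T0%:~R * (10 * y ^+ 2)%:~R :> 'F_l.
  by rewrite -rmorphM; congr (_%:~R); ring.
have castE (m n : int) : m = n -> m%:~R = n%:~R :> 'F_l by move=> ->.
apply: (place_algebra (C := c%:~R) (D := d%:~R) (b := b%:~R) (P := p%:Z%:~R)) => //.
- by have := castE _ _ T0E; rewrite rmorphM (rmorphD _ _ (b ^+ 2)) rmorphXn.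
- have -> : 2 * B%:~R = (2 * B)%:~R :> 'F_l by rewrite rmorphM.
  rewrite (_ : 2 * B = (1 - b ^+ 2) * d + 2 * b * c); last by rewrite /B /d; ring.
  by rewrite rmorphD !rmorphM rmorphB /= rmorphXn.
- by rewrite p_cd rmorphD /= !rmorphXn.
- by rewrite p_xy rmorphD /= rmorphXn.
- by rewrite -double_nu // (place_root nuP pl lnu) mulr0.
- have <- : gev v (gconj prm) = c%:~R - d%:~R * v by rewrite /gev /= rmorphN mulNr.
  by rewrite -double_nu_conj // mulf_neq0 // place_conj_neq0.
- move=> /dvd0 lx [/dvd0 lT|/dvd0 lp]; first exact: (coprimez_prime_dvd pl cop_Tx lT lx).
  exact: (coprimez_prime_dvd pl coprime_xp lx lp).
- by move=> /dvd0 lT /dvd0 lp; apply: (coprimez_prime_dvd pl cop_Tp lT lp).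
Qed.
End AtPlace.

Lemma cop_x_nu : coprimez x (gnorm nu).
Proof.
by apply: (coprimez_places nu_primary) => l pl lw; have [] := place_nu pl lw.
Qed.

Lemma cop_B_nu : coprimez B (gnorm nu).
Proof.
by apply: (coprimez_places nu_primary) => l pl lw; have [] := place_nu pl lw.
Qed.

Lemma cop_T0_nu : coprimez T0 (gnorm nu).
Proof.
by apply: (coprimez_places nu_primary) => l pl lw; have [] := place_nu pl lw.
Qed.

Lemma cop_10y_nu : coprimez (10 * y ^+ 2) (gnorm nu).
Proof.
by apply: (coprimez_places nu_primary) => l pl lw; have [] := place_nu pl lw.
Qed.

(** Modulo s one has i = b, since 1 + b i = 0. *)
Lemma place_s0 l : prime l -> (l %| `|gnorm s0|)%N -> b%:~R = groot s0 l.
Proof.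
move=> pl ls; have v2 := place_sqr s0_primary pl ls; set v := groot s0 l in v2 *.
have := one_plus_i_s0 v2; rewrite (place_root s0_primary pl ls) mulr0 => r.
have : v * (1 + b%:~R * v) = v + b%:~R * v ^+ 2 by ring.
by rewrite -r mulr0 v2 mulrN1 => /esym/eqP; rewrite subr_eq0 => /eqP.
Qed.

Lemma place_s0_conj l : prime l -> (l %| `|gnorm s0|)%N ->
  gev (groot s0 l) prm != 0 /\ gev (groot s0 l) (gconj prm) != 0.
Proof.
move=> pl ls; have v2 := place_sqr s0_primary pl ls.
apply/andP; rewrite -negb_or -mulf_eq0 gev_norm // gnorm_prm intr_Fp_eq0 //.
by apply/negP => /(coprimez_prime_dvd pl cop_Tp); apply; rewrite dvdzE.
Qed.

Lemma B_cast (K : fieldType) :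
  B%:~R = 2 * de%:~R * (1 - b%:~R ^+ 2) + b%:~R * c%:~R :> K.
Proof. by rewrite /B; clearbody b c; ring. Qed.

(** Modulo s, where b = i and b^2 = -1, B is d + c i = i conj pi. *)
Lemma place_s0_B l : prime l -> (l %| `|gnorm s0|)%N ->
  B%:~R = groot s0 l * gev (groot s0 l) (gconj prm).
Proof.
move=> pl ls; have v2 := place_sqr s0_primary pl ls.
rewrite B_cast (place_s0 pl ls) v2.
rewrite /gev /= /d rmorphN rmorphM /=.
transitivity (groot s0 l * c%:~R - 4 * de%:~R * groot s0 l ^+ 2); last by ring.
by rewrite v2; ring.
Qed.

Lemma cop_B_T0 : coprimez B T0.
Proof.
apply: (coprimez_places s0_primary) => l pl ls; rewrite place_s0_B //.
by rewrite mulf_neq0 ?(i_neq0 (place_sqr s0_primary pl ls)) //; case: (place_s0_conj pl ls).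
Qed.

Lemma gsym_B_s0 : gsym (B, 0) s0 = gsym (0, 1) s0 + gsym (gconj prm) s0.
Proof.
apply: (gsymM s0_primary) => l pl ls; rewrite gev_real place_s0_B //.
have -> : gev (groot s0 l) (0, 1) = groot s0 l by rewrite /gev /= add0r mul1r.
by split=> //; [exact: i_neq0 (place_sqr s0_primary pl ls) | case: (place_s0_conj pl ls)].
Qed.

Lemma ratio_1i (K : fieldType) (j : K) : (2 : K) != 0 -> j ^+ 2 = -1 ->
  [/\ 1 + j != 0, 1 - j != 0 & (1 + j) / (1 - j) = j].
Proof.
move=> two j2.
have n2 : (1 + j) * (1 - j) = 2.
  by transitivity (1 - j ^+ 2); [ring | rewrite j2; ring].
have [p0 m0] : 1 + j != 0 /\ 1 - j != 0.
  by apply/andP; rewrite -negb_or -mulf_eq0 n2.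
split=> //; apply: (mulIf m0); rewrite divfK //.
by rewrite mulrBr mulr1 -expr2 j2 opprK addrC.
Qed.

(** Modulo a prime dividing x, nu is s pi / 2, and s = (1 + i) s0 contributes
    (1 + i)/(1 - i) = i besides the ratio of s0. *)
Lemma gsym_x : gsym (x, 0) nu = gsym (x, 0) prm + gsym (x, 0) s0 + (quarter x)%:~R.
Proof.
have x4 : (x = 1 %[mod 4])%Z by rewrite /x mulrC modzMDl.
have cxp : coprimez x (gnorm prm) by rewrite gnorm_prm coprime_xp.
have cxs : coprimez x (gnorm s0) by rewrite coprimez_sym.
apply: gsym_ratio_mul; rewrite ?nu_primary ?prm_primary ?s0_primary ?cop_x_nu //.
move=> q K j qK oq qx j2.
have two := two_char_neq0 qK oq; have [p0 m0 r] := ratio_1i two j2.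
have [n0 nc0] := gev_coprime_neq0 qK j2 qx cop_x_nu.
have [s_0 sc0] := gev_coprime_neq0 qK j2 qx cxs.
have [r0 rc0] := gev_coprime_neq0 qK j2 qx cxp.
have xK : (x%:~R : K) = 0 by apply/eqP; rewrite (intr_eq0_char _ qK).
have e1 := double_nu j2; have e2 := double_nu_conj j2.
rewrite xK mulr0 add0r -one_plus_i_s0 // in e1.
rewrite xK mulr0 add0r -one_minus_i_s0 // in e2.
have -> : gratio j nu = (2 * gev j nu) / (2 * gev j (gconj nu)).
  by rewrite /gratio -mulf_div divff // mul1r.
rewrite e1 e2; transitivity (gratio j prm * gratio j s0 * ((1 + j) / (1 - j))).
  rewrite /gratio; field.
  by rewrite m0 sc0 rc0.
by rewrite r.
Qed.

Lemma B_mod4 : (B = 1 %[mod 4])%Z.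
Proof.
have -> : B = (be * c + ga - 2 * de * be * (b + 1)) * 4 + 1.
  by rewrite /B /b /c; ring.
by rewrite modzMDl.
Qed.

(** Modulo a prime dividing B, twice s nu is (1 + b^2) x + s^2 pi, which is
    real; so the ratio of nu is inverse to that of s. *)
Lemma gsym_B : gsym (B, 0) nu + gsym (B, 0) s0 = - (quarter B)%:~R.
Proof.
apply: gsym_ratio_inv; rewrite ?nu_primary ?s0_primary ?cop_B_nu ?cop_B_T0 ?B_mod4 //.
move=> q K j qK oq qB j2.
have two := two_char_neq0 qK oq; have [p0 m0 r] := ratio_1i two j2.
have [n0 nc0] := gev_coprime_neq0 qK j2 qB cop_B_nu.
have [s_0 sc0] := gev_coprime_neq0 (w := s0) qK j2 qB cop_B_T0.
have BK : (B%:~R : K) = 0 by apply/eqP; rewrite (intr_eq0_char _ qK).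
have BE : 4 * de%:~R * (1 - b%:~R ^+ 2) = - (2 * b%:~R * c%:~R) :> K.
  apply/eqP; rewrite -addr_eq0; apply/eqP; rewrite -[RHS](mulr0 2) -BK.
  by rewrite B_cast; ring.
have W : (1 + j) * gev j s0 * (2 * gev j nu) = (1 - j) * gev j (gconj s0) * (2 * gev j (gconj nu)).
  rewrite double_nu // double_nu_conj // one_plus_i_s0 // one_minus_i_s0 //.
  apply/eqP; rewrite -subr_eq0; apply/eqP; rewrite /gev /prm /gconj /= /d rmorphN rmorphM /=.
  transitivity (2 * j * (4 * de%:~R * (1 - b%:~R ^+ 2) + 2 * b%:~R * c%:~R)
    + 8 * de%:~R * b%:~R ^+ 2 * j * (j ^+ 2 + 1)); first by ring.
  by rewrite BE j2 !addNr !mulr0 addr0.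
have -> : gratio j nu * gratio j s0 = (1 - j) / (1 + j).
  rewrite /gratio mulf_div; apply/eqP; rewrite eqr_div ?mulf_neq0 //.
  apply/eqP/(mulfI two).
  transitivity ((1 + j) * gev j s0 * (2 * gev j nu)); first by ring.
  by rewrite W; ring.
by rewrite -[in RHS]r invf_div.
Qed.

(** At a prime factor of T0 take i = b; then 1 + b i = 0 and 1 - b i = 2, so
    that nu = x and conj nu = conj pi. *)
Lemma gsym_T0 : gsym (T0, 0) nu = gsym (x, 0) s0 - gsym (gconj prm) s0.
Proof.
have T04 := gnorm_mod4 s0_primary.
rewrite (gsym_star nu_primary T04 cop_T0_nu) -lsumN -lsumD; apply: eq_lsum => l pl ls.
have ol := place_odd s0_primary ls; have v2 := place_sqr s0_primary pl ls.
have l4 := sqrtN1_mod4 pl ol v2; rewrite /star l4 /=.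
have [r0 rc0] := place_s0_conj pl ls.
rewrite (gsym_split pl ol v2 nu_primary); last first.
  apply/negP => ln; case: (place_nu pl ln) => _ /negP T0n _ _ _; apply: T0n.
  by rewrite intr_Fp_eq0 // dvdzE.
have x0 : (x%:~R : 'F_l) != 0.
  rewrite intr_Fp_eq0 //; apply/negP; apply: (coprimez_prime_dvd pl cop_Tx).
  by rewrite dvdzE.
rewrite gev_real -qlogV // -qlogM ?invr_eq0 //; congr (qlog _ _).
have two := two_Fp_neq0 pl ol.
have -> : gratio (groot s0 l) nu = (2 * gev (groot s0 l) nu) / (2 * gev (groot s0 l) (gconj nu)).
  by rewrite /gratio -mulf_div divff // mul1r.
rewrite double_nu // double_nu_conj // (place_s0 pl ls) -expr2 v2 opprK subrr !mul0r addr0 add0r.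
by rewrite -mulf_div divff ?mul1r.
Qed.

Let u := groot prm p.

Lemma prm_p : (p %| `|gnorm prm|)%N. Proof. by rewrite absz_gnorm_prm. Qed.

Lemma odd_p : odd p. Proof. exact: place_odd prm_primary prm_p. Qed.

Lemma u_sqr : u ^+ 2 = -1. Proof. exact: place_sqr prm_primary pp prm_p. Qed.

Lemma u_root : c%:~R + d%:~R * u = 0. Proof. exact: place_root prm_primary pp prm_p. Qed.

Lemma gsym_prm z : gsym z prm = qlog u (gev u z).
Proof. by rewrite /gsym absz_gnorm_prm lsum_prime. Qed.

Lemma p_neq0 (n : int) : coprimez n p -> (n%:~R : 'F_p) != 0.
Proof.
move=> cn; rewrite intr_Fp_eq0 //; apply/negP => pn.
by apply: (coprimez_prime_dvd pp cn pn); rewrite dvdzE.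
Qed.

Lemma coprime_yp : coprimez y p.
Proof.
rewrite coprimez_sym coprimezE prime_coprime //; apply/negP => py.
have : (p %| x ^+ 2)%Z.
  have -> : x ^+ 2 = p%:Z - 10 * y * y by rewrite p_xy; ring.
  by rewrite rpredB //= ?dvdzz // dvdz_mull.
rewrite dvdzE abszX Euclid_dvdX // andbT => px.
exact: (coprimez_prime_dvd pp coprime_xp px).
Qed.

Lemma p_cast (K : fieldType) : (p%:Z)%:~R = x%:~R ^+ 2 + (10 * y ^+ 2)%:~R :> K.
Proof. by rewrite p_xy; clearbody x y; rewrite rmorphD rmorphXn. Qed.

(** Modulo a prime dividing y the norm p of pi is x^2, so that
    x nu = pi conj nu, and pi / conj pi = (pi / x)^2. *)
Lemma gsym_y0 y0 : (y0 = 1 %[mod 4])%Z -> (y0 %| y)%Z ->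
  gsym (y0, 0) prm = gsym (y0, 0) nu *+ 2.
Proof.
move=> y04 y0y.
have cp : coprimez y0 (gnorm prm).
  by rewrite gnorm_prm; apply: coprimez_dvdl coprime_yp; rewrite -dvdzE.
have cn : coprimez y0 (gnorm nu).
  by apply: coprimez_dvdl cop_10y_nu; rewrite -dvdzE expr2 dvdz_mull // dvdz_mull.
apply: gsym_ratio_sq; rewrite ?nu_primary ?prm_primary //.
move=> q K j qK oq qy j2.
have two := two_char_neq0 qK oq.
have [n0 nc0] := gev_coprime_neq0 qK j2 qy cn.
have [r0 rc0] := gev_coprime_neq0 qK j2 qy cp.
have yK : (y%:~R : K) = 0.
  by apply/eqP; rewrite (intr_eq0_char _ qK) (dvdz_trans qy).
have PX : gev j prm * gev j (gconj prm) = x%:~R ^+ 2.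
  rewrite gev_norm // gnorm_prm p_cast rmorphM rmorphXn /= yK.
  by rewrite expr0n mulr0 addr0.
have x0 : (x%:~R : K) != 0.
  by apply: contraNneq r0 => x0; move/eqP: PX; rewrite x0 expr0n mulf_eq0 (negbTE rc0) orbF.
have cross : x%:~R * gev j nu = gev j prm * gev j (gconj nu).
  apply: (mulfI two); rewrite mulrCA double_nu // [RHS]mulrCA double_nu_conj //.
  transitivity ((1 - b%:~R * j) * x%:~R ^+ 2 + (1 + b%:~R * j) * gev j prm * x%:~R).
    by ring.
  by rewrite -PX; ring.
have rn : gratio j nu = gev j prm / x%:~R.
  by apply/eqP; rewrite /gratio eqr_div // mulrC cross.
by rewrite rn /gratio expr_div_n -PX; field; rewrite r0 rc0.
Qed.

(** The relation of place_nu, divided by 2 and read through the quartic symbol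
    modulo nu; twice the symbol of 2 is twice that of i by qlog_four. *)
Lemma nu_relation t y0 : y = 2 ^+ t * y0 ->
  gsym (5, 0) nu + gsym (T0, 0) nu + gsym (0, 1) nu *+ (2 * t) + gsym (y0, 0) nu *+ 2
  = gsym (x, 0) nu + gsym (B, 0) nu + gsym (0, 1) nu.
Proof.
move=> yE; rewrite /gsym -2!lsumMn -5!lsumD; apply: eq_lsum => l pl ln.
have nuP := nu_primary; have ol := place_odd nuP ln; have v2 := place_sqr nuP pl ln.
have [x0 T0n y10 B0 rel] := place_nu pl ln; rewrite !gev_real.
set v := groot nu l in v2 rel *; have two := two_Fp_neq0 pl ol.
have -> : gev v (0, 1) = v by rewrite /gev /= add0r mul1r.
have v0 := i_neq0 v2; clearbody v.
have yI : 10 * y ^+ 2 = 2 * 5 * 2 ^+ (2 * t) * y0 ^+ 2.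
  by rewrite yE mulnC exprM; ring.
have yF : (10 * y ^+ 2)%:~R = 2 * 5%:~R * 2 ^+ (2 * t) * y0%:~R ^+ 2 :> 'F_l.
  by rewrite yI !rmorphM !rmorphXn.
have f0 : (5%:~R : 'F_l) != 0 by apply: contraNneq y10 => z0; rewrite yF z0 mulr0 !mul0r.
have y00 : (y0%:~R : 'F_l) != 0.
  by apply: contraNneq y10 => z0; rewrite yF z0 expr0n mulr0.
have E : 5%:~R * T0%:~R * 2 ^+ (2 * t) * y0%:~R ^+ 2 = x%:~R * B%:~R * v :> 'F_l.
  apply: (mulfI two); transitivity ((10 * T0 * y ^+ 2)%:~R : 'F_l); last first.
    by rewrite rel; ring.
  have -> : 10 * T0 * y ^+ 2 = T0 * (10 * y ^+ 2) by ring.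
  by rewrite (rmorphM _ T0 (10 * y ^+ 2)) /= yF; ring.
exact: qlog_relation.
Qed.

(** Modulo 5 again p = x^2, so the ratio of nu is pi / x; the quartic power
    map of the field with five elements is the identity, and 2 plays the role
    of i. *)
Lemma gsym_five : ~~ (5 %| p)%N ->
  expi (2 : 'F_5) (gsym (5, 0) nu) * x%:~R = (c + 2 * d)%:~R.
Proof.
move=> p5; have p5' : prime 5 by [].
have v2 : (2 : 'F_5) ^+ 2 = -1 by apply/val_inj.
have two : (2 : 'F_5) != 0 by [].
have five0 : (10 * y ^+ 2)%:~R = 0 :> 'F_5.
  by apply/eqP; rewrite intr_Fp_eq0 //; apply/dvdzP; exists (2 * y ^+ 2); ring.
have PX : gev 2 prm * gev 2 (gconj prm) = x%:~R ^+ 2 :> 'F_5.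
  by rewrite gev_norm // gnorm_prm p_cast five0 addr0.
have x0 : (x%:~R : 'F_5) != 0.
  apply: contraNneq p5 => x0; have := intr_Fp_eq0 p p5'.
  rewrite dvdzE /= => <-; rewrite p_cast five0 addr0.
  by rewrite x0.
have n5 : ~~ (5 %| `|gnorm nu|)%N.
  apply/negP => n5; have [_ _ /negP y0 _ _] := place_nu p5' n5.
  by apply: y0; rewrite five0.
rewrite (gsym_split p5' _ v2 nu_primary n5) //.
have nn : gev 2 nu * gev 2 (gconj nu) != 0 :> 'F_5.
  by rewrite gev_norm // intr_Fp_eq0 // dvdzE.
move: (nn); rewrite mulf_eq0 negb_or => /andP[n0 nc0].
have cross : x%:~R * gev 2 nu = gev 2 prm * gev 2 (gconj nu) :> 'F_5.
  apply: (mulfI two); rewrite mulrCA double_nu // [RHS]mulrCA double_nu_conj //.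
  transitivity ((1 - b%:~R * 2) * x%:~R ^+ 2 + (1 + b%:~R * 2) * gev 2 prm * x%:~R : 'F_5).
    by ring.
  by rewrite -PX; ring.
rewrite qlogP //; last by rewrite /gratio mulf_neq0 ?invr_eq0.
rewrite expr1 /gratio mulrAC mulrC [_ * x%:~R]mulrC cross mulrCA mulVf // mulr1.
by rewrite /gev /=; clearbody c d; ring.
Qed.

Lemma u_neq0 : u != 0. Proof. exact: i_neq0 u_sqr. Qed.

Lemma c_neq0 : (c%:~R : 'F_p) != 0.
Proof.
have d0 := place_snd_neq0 prm_primary pp prm_p.
have /eqP := u_root; rewrite addr_eq0 => /eqP ->.
by rewrite oppr_eq0 mulf_neq0 // u_neq0.
Qed.

(** Both numbers are rational, so this makes the symbol of 1 + i accessible to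
    rational reciprocity. *)
Lemma c_mul_1u : c%:~R * (1 + u) = (c + d)%:~R.
Proof.
have /eqP := u_root; rewrite addr_eq0 => /eqP cE.
rewrite (rmorphD _ c d) /= mulrDr mulr1 {2}cE mulNr -mulrA -expr2 u_sqr mulrN1 opprK.
by [].
Qed.

Lemma coprime_prm n : (n%:~R : 'F_p) != 0 -> coprimez n (gnorm prm).
Proof.
move=> n0; rewrite gnorm_prm coprimez_sym coprimezE prime_coprime //.
by rewrite -[p]/(`|p%:Z|%N) -dvdzE -intr_Fp_eq0.
Qed.

Lemma quarter4 n : quarter (4 * n + 1) = n.
Proof. by rewrite /quarter addrK mulrC mulzK. Qed.

Lemma one_mod4 n : (4 * n + 1 = 1 %[mod 4])%Z.
Proof. by rewrite mulrC modzMDl. Qed.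

(** Modulo a prime dividing c, pi = d i and its ratio is -1. *)
Lemma qlog_c : qlog u c%:~R = ga%:~R *+ 2.
Proof.
have := @gsym_ratio_i c prm 2 (one_mod4 ga) prm_primary (coprime_prm c_neq0).
rewrite gsym_prm gev_real quarter4; apply=> q K j qK oq qc j2.
have [r0 rc0] := gev_coprime_neq0 qK j2 qc (coprime_prm c_neq0).
have cK : (c%:~R : K) = 0 by apply/eqP; rewrite (intr_eq0_char _ qK).
have e : gev j prm = - gev j (gconj prm).
  by rewrite /gev /= cK !add0r rmorphN mulNr opprK.
by rewrite /gratio e mulNr divff // j2.
Qed.

(** Modulo a prime dividing c + d, pi is proportional to 1 - i, with ratio
    - i = i^3. *)
Lemma qlog_cd : qlog u (c + d)%:~R = (ga + de)%:~R *+ 3.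
Proof.
have [u1 _] := qlog_two pp odd_p u_sqr.
have cd0 : ((c + d)%:~R : 'F_p) != 0 by rewrite -c_mul_1u mulf_neq0 // c_neq0.
have cdE : c + d = 4 * (ga + de) + 1 by rewrite /c /d; ring.
have cd4 : (c + d = 1 %[mod 4])%Z by rewrite cdE one_mod4.
have := @gsym_ratio_i (c + d) prm 3 cd4 prm_primary (coprime_prm cd0).
have qE : quarter (c + d) = ga + de by rewrite cdE quarter4.
rewrite gsym_prm gev_real qE; apply=> q K j qK oq qc j2.
have [r0 rc0] := gev_coprime_neq0 qK j2 qc (coprime_prm cd0).
have /eqP cK : (c%:~R + d%:~R : K) == 0 by rewrite -(rmorphD _ c d) (intr_eq0_char _ qK).
apply: (mulIf rc0); rewrite /gratio divfK // exprS j2 mulrN1.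
rewrite /gev /= rmorphN /=; apply/eqP; rewrite -subr_eq0; apply/eqP.
transitivity ((c%:~R + d%:~R) * (1 + j) - d%:~R * (j ^+ 2 + 1)); first by ring.
by rewrite cK j2 addNr mulr0 mul0r subrr.
Qed.

Lemma qlog_1u : qlog u (1 + u) = (ga + de)%:~R *+ 3 - ga%:~R *+ 2.
Proof.
have [u1 _] := qlog_two pp odd_p u_sqr.
rewrite -qlog_cd -c_mul_1u qlogM ?c_neq0 //; try exact: odd_p; try exact: u_sqr.
by rewrite qlog_c addrAC subrr add0r.
Qed.

Lemma gsym_i_nu : gsym (0, 1) nu =
  (ga%:~R + xi%:~R - de%:~R) ^+ 2 + (ga%:~R + xi%:~R - de%:~R)
  + (de%:~R + ga%:~R - xi%:~R) ^+ 2.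
Proof.
rewrite (gsym_i nu_primary).
have -> : gnorm nu = 4 * ((ga + xi - b * de) ^+ 2 + (ga + xi - b * de)
    + (de + b * (ga - xi)) ^+ 2) + 1 by rewrite /gnorm /=; ring.
rewrite quarter4; have bE : b%:~R = 1 :> 'Z_4.
  by apply: (eq_cast_Z4 (n := 1) (k := be)); rewrite /b addrC.
clearbody b; transitivity ((ga%:~R + xi%:~R - b%:~R * de%:~R) ^+ 2 +
  (ga%:~R + xi%:~R - b%:~R * de%:~R) + (de%:~R + b%:~R * (ga%:~R - xi%:~R)) ^+ 2 : 'Z_4).
  by ring.
by rewrite bE; ring.
Qed.

Lemma gsym_i_s0 : gsym (0, 1) s0 = 2 * be%:~R ^+ 2 + be%:~R.
Proof.
rewrite (gsym_i s0_primary).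
have -> : gnorm s0 = 4 * (2 * be ^+ 2 + be) + 1 by rewrite /gnorm /=; ring.
by rewrite quarter4; ring.
Qed.

Lemma quarter_B : (quarter B)%:~R = be%:~R + ga%:~R :> 'Z_4.
Proof.
have -> : B = 4 * (be * c + ga - 2 * de * be * (b + 1)) + 1 by rewrite /B /b /c; ring.
rewrite quarter4 -rmorphD; apply: (eq_cast_Z4 (k := be * ga - de * be * (2 * be + 1))).
by rewrite /b /c; ring.
Qed.

Lemma p_ga : p%:Z = 8 * (2 * ga ^+ 2 + ga + 2 * de ^+ 2) + 1.
Proof. by rewrite p_cd /c /d; ring. Qed.

(** Eliminate the symbols modulo nu and s0 between the preceding relations. *)
Lemma octic_exponent t y0 : y = 2 ^+ t * y0 -> (y0 = 1 %[mod 4])%Z ->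
  qlog u x%:~R - qlog u y%:~R - qlog u (1 + u) + ((p - 1) %/ 8)%:R
  = gsym (5, 0) nu + 2 * (de%:~R + eta%:~R).
Proof.
move=> yE y04; have op := odd_p; have u2 := u_sqr.
have two := two_Fp_neq0 pp op; have [u1 qtwo] := qlog_two pp op u2.
have y0p : (y0%:~R : 'F_p) != 0.
  apply: contraNneq (p_neq0 coprime_yp) => z0; rewrite yE.
  by rewrite (rmorphM _ (2 ^+ t) y0) /= z0 mulr0.
have mE : ((p - 1) %/ 8)%:R = 2 * ga%:~R ^+ 2 + ga%:~R + 2 * de%:~R ^+ 2 :> 'Z_4.
  have := p_ga; have := prime_gt1 pp.
  have -> : 2 * ga%:~R ^+ 2 + ga%:~R + 2 * de%:~R ^+ 2
    = (2 * ga ^+ 2 + ga + 2 * de ^+ 2)%:~R :> 'Z_4 by ring.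
  move: (2 * ga ^+ 2 + _ + _) => m p1 pm.
  by have -> : m = ((p - 1) %/ 8)%N by clear -p1 pm; lia.
have quE : qlog u u = ((p - 1) %/ 8)%:R *+ 2.
  rewrite qlog_i // -mulrnA; congr (_%:R).
  have := p_ga; have := prime_gt1 pp; move: (2 * ga ^+ 2 + _ + _) => m p1 pm.
  by clear -p1 pm; lia.
have qy : qlog u y%:~R = qlog u 2 *+ t + qlog u y0%:~R.
  rewrite yE (rmorphM _ (2 ^+ t) y0) /= rmorphXn /=.
  by rewrite qlogM ?expf_neq0 // qlogX.
have y0y : (y0 %| y)%Z by rewrite yE dvdz_mull.
have Th : 2 * t%:R * eta%:~R = 2 * eta%:~R :> 'Z_4.
  case: t yE {qy} => [|[|t]] yE.
  - by move: y04; rewrite -[y0]mul1r -(expr0 2) -yE /y; lia.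
  - by rewrite mulr1.
  have -> : eta = 2 * (2 ^+ t * y0).
    by apply: (@mulfI _ (2 : int)) => //; rewrite -/y yE !exprS; ring.
  clear yE; move: (2 ^+ t * y0) => k.
  rewrite (_ : (2 * k)%:~R = 2 * k%:~R :> 'Z_4); last by ring.
  rewrite (_ : 2 * (2 * _) = 4 * k%:~R); last by ring.
  rewrite (_ : 2 * _ * (2 * _) = 4 * (t.+2%:R * k%:~R)); last by ring.
  by rewrite !Z4_four.
have H : 2 * ga%:~R ^+ 2 + ga%:~R + 2 * de%:~R ^+ 2
    = 2 * xi%:~R ^+ 2 + xi%:~R + 5 * eta%:~R ^+ 2 :> 'Z_4.
  have e : 2 * ga ^+ 2 + ga + 2 * de ^+ 2 = 2 * xi ^+ 2 + xi + 5 * eta ^+ 2.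
    apply: (@mulfI _ (8 : int)) => //; apply: (addIr 1); rewrite -p_ga p_xy /x /y; ring.
  transitivity ((2 * ga ^+ 2 + ga + 2 * de ^+ 2)%:~R : 'Z_4); first by ring.
  by rewrite e; ring.
have Id := exponent_identity be%:~R H Th.
have R0 := nu_relation yE; have Rx := gsym_x; have RB := gsym_B; have RBs := gsym_B_s0.
have RT := gsym_T0; have Ry := gsym_y0 y04 y0y.
rewrite quarter_B in RB; rewrite gsym_i_s0 in RBs; rewrite gsym_i_nu in R0.
have qx : quarter x = xi by exact: quarter4.
rewrite qx in Rx; rewrite !gsym_prm !gev_real in Rx Ry.
rewrite qtwo quE qlog_1u in qy *; rewrite qy mE {qy quE mE qtwo}.
move: R0 Rx RB RBs RT Ry Id.
move: (gsym (5, 0) nu) (gsym (T0, 0) nu) (gsym (y0, 0) nu) (gsym (x, 0) nu) (gsym (B, 0) nu)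
  (gsym (B, 0) s0) (gsym (x, 0) s0) (gsym (gconj prm) s0) (qlog u x%:~R) (qlog u y0%:~R)
  => f5 fT fy fx fB sB sx sp X Y0 R0 Rx RB RBs RT Ry Id.
have {}RB : fB = - (be%:~R + ga%:~R) - sB by rewrite -RB addrK.
have {}R0 : f5 = fx + fB - fT - Y0 + (1 - 2 * t%:R) * ((ga%:~R + xi%:~R - de%:~R) ^+ 2
  + (ga%:~R + xi%:~R - de%:~R) + (de%:~R + ga%:~R - xi%:~R) ^+ 2).
  move: R0; set n := _ ^+ 2 + _ + _; rewrite -Ry -(mulr_natr n) natrM => R0.
  transitivity (f5 + fT + n * (2 * t%:R) + Y0 - fT - Y0 - n * (2 * t%:R)).
    by ring.
  by rewrite R0; ring.
rewrite R0 Rx RB RBs RT -[_ *+ t]mulr_natr.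
apply/eqP; rewrite -subr_eq0; apply/eqP.
by move/eqP: Id; rewrite -subr_eq0 => /eqP <-; ring.
Qed.

Lemma octic_power t y0 : y = 2 ^+ t * y0 -> (y0 = 1 %[mod 4])%Z ->
  (-5 : 'F_p) ^+ ((p - 1) %/ 8) = expi u (gsym (5, 0) nu + 2 * (de%:~R + eta%:~R)).
Proof.
move=> yE y04; have op := odd_p; have u2 := u_sqr; have [u1 _] := qlog_two pp op u2.
have two := two_Fp_neq0 pp op; have u0 := u_neq0.
have x0 := p_neq0 coprime_xp; have y_0 := p_neq0 coprime_yp.
have w2 : (1 + u) ^+ 2 = 2 * u.
  by transitivity (u ^+ 2 + 1 + 2 * u); [ring | rewrite u2 addNr add0r].
have m5 : (-5 : 'F_p) = (x%:~R / (y%:~R * (1 + u))) ^+ 2 * u.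
  have xx : x%:~R ^+ 2 = - 10 * y%:~R ^+ 2 :> 'F_p.
    have : (p%:Z)%:~R = 0 :> 'F_p by exact: pchar_Fp_0.
    rewrite p_cast (rmorphM _ 10 (y ^+ 2)) rmorphXn /= => /eqP.
    by rewrite addr_eq0 => /eqP ->; rewrite mulNr.
  rewrite expr_div_n exprMn w2 xx; field.
  by rewrite u0 y_0 two.
rewrite m5 exprMn -exprM.
have n4 : (2 * ((p - 1) %/ 8) = (p - 1) %/ 4)%N.
  have := p_ga; have := prime_gt1 pp; move: (2 * ga ^+ 2 + _ + _) => m p1 pm.
  by clear -p1 pm; lia.
have z0 : x%:~R / (y%:~R * (1 + u)) != 0 :> 'F_p.
  by rewrite mulf_neq0 // invr_eq0 mulf_neq0.
rewrite n4 -(qlogP pp op u2 z0) -(octic_exponent yE y04) expiD // expi_nat //.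
have yu0 := mulf_neq0 y_0 u1; have V0 : (y%:~R * (1 + u))^-1 != 0 by rewrite invr_eq0.
by rewrite (qlogM pp op u2 x0 V0) (qlogV pp op u2 yu0) (qlogM pp op u2 y_0 u1) opprD addrA.
Qed.
End AuxiliaryInteger.

(** * Choice of b and conclusion *)

Lemma coprimez_primes (a b : int) : a != 0 ->
  (forall l, prime l -> (l %| a)%Z -> (l %| b)%Z -> False) -> coprimez a b.
Proof.
move=> a0 H; rewrite coprimezE /coprime; apply: contraT => g1.
have g0 : (0 < gcdn `|a| `|b|)%N by rewrite gcdn_gt0 absz_gt0 a0.
have pl : prime (pdiv (gcdn `|a| `|b|)) by rewrite pdiv_prime // ltn_neqAle eq_sym g1.
case: (H _ pl); rewrite dvdzE /=; apply: dvdn_trans (pdiv_dvd _) _.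
  exact: dvdn_gcdl.
exact: dvdn_gcdr.
Qed.

Lemma prime_dvdzM l (a b : int) : prime l -> (l %| a * b)%Z = (l %| a)%Z || (l %| b)%Z.
Proof. by move=> pl; rewrite !dvdzE abszM Euclid_dvdM. Qed.

(** Let P = (x + c)/2, Q = d/2 and R = (c - x)/2, so that nu is
    (P - b Q) + (Q + b R) i.  A prime l dividing both parts divides
    P R + Q^2 = 10 eta^2 and is odd, so l divides 5 eta.  If l divides P and Q,
    then it does not divide R, so nu vanishes modulo l only for b divisible by
    l; for the other l it is enough to take b divisible by l.  So b is, up to
    sign, x p times the part of 5 eta prime to 2 and to the gcd of P and Q. *)
Lemma auxiliary_slope (p : nat) (ga de xi eta : int) : prime p ->
  p%:Z = (4 * ga + 1) ^+ 2 + (4 * de) ^+ 2 ->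
  p%:Z = (4 * xi + 1) ^+ 2 + 10 * (2 * eta) ^+ 2 ->
  exists be : int, let b := 4 * be + 1 in
    ((4 * xi + 1) * p%:Z %| b)%Z /\
    coprimez (2 * ga + 2 * xi + 1 - b * (2 * de)) (2 * de + b * (2 * (ga - xi))).
Proof.
move=> pp pcd pxy.
have [x xE] : exists x, x = 4 * xi + 1 by exists (4 * xi + 1).
have [P PE] : exists P, P = 2 * ga + 2 * xi + 1 by exists (2 * ga + 2 * xi + 1).
have [Q QE] : exists Q, Q = 2 * de by exists (2 * de).
have [R RE] : exists R, R = 2 * (ga - xi) by exists (2 * (ga - xi)).
rewrite -xE -PE -QE -RE; rewrite -xE in pxy.
have op : odd p.
  have := pcd; have -> : (4 * ga + 1) ^+ 2 + (4 * de) ^+ 2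
    = 2 * (8 * ga ^+ 2 + 4 * ga + 8 * de ^+ 2) + 1 by ring.
  by move: (8 * _ + _ + _) => k; clear; lia.
have eta0 : eta != 0.
  apply/eqP => eta0; apply: (@prime_nonsquare p x) => //.
  by rewrite pxy eta0; ring.
pose g := gcdz P Q.
pose rho := [pred l : nat | (l != 2)%N && ~~ (l %| g)%Z].
pose w := ((5 * `|eta|)`_rho)%N.
have n0 : (0 < 5 * `|eta|)%N by rewrite muln_gt0 absz_gt0.
have wP l : prime l -> (l %| w)%N = [&& l != 2%N, ~~ (l %| g)%Z & (l %| 5 * `|eta|)%N].
  move=> pl; have w0 : (0 < w)%N by exact: part_gt0.
  have := pi_of_part rho n0 l; rewrite !inE !mem_primes pl w0 n0 /= => ->.
  by rewrite andbC andbA.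
have ow : odd w.
  by rewrite -[odd w]negbK -dvdn2 wP.
have [be beE] : exists be, 4 * be + 1 = x * p * w%:Z \/ 4 * be + 1 = - (x * p * w%:Z).
  have [k kE] : exists k, x * p * w%:Z = 2 * k + 1.
    have [p' ->] : exists p', p%:Z = 2 * p' + 1 by exists (Posz (p %/ 2)); lia.
    have [w' ->] : exists w', w%:Z = 2 * w' + 1 by exists (Posz (w %/ 2)); lia.
    exists ((2 * xi) * ((2 * p' + 1) * (2 * w' + 1)) + p' * (2 * w' + 1) + w').
    by rewrite xE; ring.
  rewrite kE; clear; have [k2|k2] : (k %% 2 = 0)%Z \/ (k %% 2 = 1)%Z by lia.
    by exists (k %/ 2)%Z; left; lia.
  by exists (- (k %/ 2)%Z - 1); right; lia.
exists be => b.
have bE (m : int) : (m %| b)%Z = (m %| x * p%:Z * w%:Z)%Z.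
  by rewrite /b; case: beE => -> //; rewrite dvdzE abszN.
split; first by rewrite bE dvdz_mulr.
have cd_contra l : prime l -> (l %| 4 * ga + 1)%Z -> (l %| 4 * de)%Z -> False.
  by move=> pl; apply: coprimez_prime_dvd pl _; case/andP: (prm_primary pp pcd).
have oddPQ : P - b * Q = 2 * (ga + xi - b * de) + 1 by rewrite PE QE; ring.
apply: coprimez_primes => [|l pl].
  by rewrite oddPQ; move: (ga + xi - b * de); clear; lia.
move=> l1 l2.
have lne2 : l != 2%N.
  apply: contraTneq l1 => ->; rewrite oddPQ; move: (ga + xi - b * de) => k.
  by clear; lia.
have l10 : (l %| 5 * `|eta|)%N.
  have : (l %| 2 * (5 * eta) * eta)%Z.
    have -> : 2 * (5 * eta) * eta = R * (P - b * Q) + Q * (Q + b * R).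
      apply: (@mulfI _ (4 : int)) => //.
      transitivity (p%:Z - x ^+ 2); first by rewrite pxy; ring.
      by rewrite pcd PE QE RE xE; ring.
    by rewrite rpredD ?dvdz_mull.
  rewrite !prime_dvdzM // !dvdzE /= dvdn_prime2 // (negbTE lne2) /= Euclid_dvdM //.
  by case/orP=> // ->; rewrite orbT.
have [lg|lg] := boolP (l %| g)%Z.
  have [lP lQ] : (l %| P)%Z /\ (l %| Q)%Z by apply/andP; rewrite -dvdz_gcd.
  have ld : (l %| 4 * de)%Z by apply: dvdz_trans lQ _; apply/dvdzP; exists 2; rewrite QE; ring.
  have lc : (l %| R)%Z -> (l %| 4 * ga + 1)%Z.
    move=> lR; have -> : 4 * ga + 1 = P + R by rewrite PE RE; ring.
    by rewrite rpredD.
  have : (l %| b * R)%Z.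
    by rewrite -[b * R](addKr Q) rpredD // rpredN.
  rewrite prime_dvdzM // => /orP[lb|/lc lc']; last exact: (cd_contra l).
  move: lb; rewrite bE !prime_dvdzM // => /orP[/orP[lx|lp]|].
  - apply: (cd_contra l) => //; apply: lc.
    have -> : R = P - x by rewrite PE RE xE; ring.
    by rewrite rpredB.
  - apply: (cd_contra l) => //.
    have : (l %| (4 * ga + 1) ^+ 2)%Z.
      have -> : (4 * ga + 1) ^+ 2 = p%:Z - 4 * de * (4 * de) by rewrite pcd; ring.
      by rewrite rpredB // dvdz_mull.
    by rewrite expr2 prime_dvdzM // orbb.
  by rewrite dvdzE /= wP // lg andbF.
have lb : (l %| b)%Z.
  by rewrite bE dvdz_mull // dvdzE /= wP // lne2 lg.
case/negP: lg; rewrite dvdz_gcd; apply/andP; split.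
  by rewrite -[P](subrK (b * Q)) rpredD // dvdz_mulr.
by rewrite -[Q](addrK (b * R)) rpredB // dvdz_mulr.
Qed.

(** The sign of y may be changed, as y enters only through y^2 and the parity
    of y / 2; this makes the odd part congruent to 1 modulo 4. *)
Lemma two_part (y : int) : y != 0 -> exists t y0,
  (y0 = 1 %[mod 4])%Z /\ (y = 2 ^+ t * y0 \/ - y = 2 ^+ t * y0).
Proof.
move=> y0; exists (logn 2 `|y|).
have n0 : (0 < `|y|)%N by rewrite absz_gt0.
have [m om yE] := pfactor_coprime (isT : prime 2) n0.
rewrite coprime2n in om.
have e : (`|y|%N)%:Z = 2 ^+ logn 2 `|y| * m%:Z.
  have XE k : (2 ^ k)%N%:Z = (2%:Z) ^+ k.
    by elim: k => // k IHk; rewrite expnS PoszM IHk exprS.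
  rewrite [LHS](congr1 Posz yE) PoszM XE; exact: mulrC.
have yy : y = `|y|%N \/ - y = `|y|%N by clear; lia.
have [m4|m4] := odd_mod4 om.
  exists m%:Z; split; first by clear -m4; lia.
  by rewrite -e.
exists (- m%:Z); split; first by clear -m4; lia.
by rewrite mulrN -e; case: yy => yE'; [right; rewrite {1}yE' | left; rewrite -yE' opprK].
Qed.

(** The theorem for x congruent to 1 modulo 4, before the four cases of k are
    told apart; c + 2 d is - 2 (2 c - d) modulo 5. *)
Lemma octic_value (p : nat) (ga de xi eta : int) : prime p -> ~~ (5 %| p)%N ->
  p%:Z = (4 * ga + 1) ^+ 2 + (4 * de) ^+ 2 ->
  p%:Z = (4 * xi + 1) ^+ 2 + 10 * (2 * eta) ^+ 2 ->
  let u : 'F_p := groot (4 * ga + 1, 4 * de) p in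
  exists k : 'Z_4,
    expi (2 : 'F_5) k * (4 * xi + 1)%:~R = (4 * ga + 1 + 2 * (4 * de))%:~R /\
    (-5 : 'F_p) ^+ ((p - 1) %/ 8) = expi u (k + 2 * (de%:~R + eta%:~R)).
Proof.
move=> pp p5 pcd pxy u.
have [be [xpb cop]] := auxiliary_slope pp pcd pxy.
have copT m : (m %| (4 * xi + 1) * p%:Z)%Z -> coprimez (gnorm (2 * be + 1, 2 * be)) m.
  move=> mxp; have /dvdzP[b' bE] := dvdz_trans mxp xpb.
  apply/coprimezP; exists (2, - (b' * (4 * be + 1))) => /=.
  rewrite mulNr mulrAC -bE /gnorm /=; ring.
have eta0 : 2 * eta != 0.
  apply/eqP => eta0; apply: (@prime_nonsquare p (4 * xi + 1)) => //.
  by rewrite pxy eta0; ring.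
have [t [y0 [y04 yE]]] := two_part eta0.
have [eta' [etaE pxy' yE']] : exists eta', [/\ eta'%:~R *+ 2 = eta%:~R *+ 2 :> 'Z_4,
    p%:Z = (4 * xi + 1) ^+ 2 + 10 * (2 * eta') ^+ 2 & 2 * eta' = 2 ^+ t * y0].
  case: yE => yE; first by exists eta.
  exists (- eta); split; [|by rewrite pxy; ring | by rewrite -yE; ring].
  rewrite rmorphN /= mulNrn; apply/eqP; rewrite eq_sym -addr_eq0 -mulrnDr.
  by rewrite mulrn4_Z4.
have cx := copT (4 * xi + 1) (dvdz_mulr _ (dvdzz _)).
have cp := copT p%:Z (dvdz_mull _ (dvdzz _)).
exists (gsym (5, 0) (2 * ga + 2 * xi + 1 - (4 * be + 1) * (2 * de),
   2 * de + (4 * be + 1) * (2 * (ga - xi)))); split.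
  exact: (gsym_five pp pcd pxy cop cx cp p5).
rewrite (octic_power pp pcd pxy' cop cx cp yE' y04) -!/u.
congr (expi _ (_ + _)).
by rewrite !mulrDr ![2 * _]mulr_natl etaE.
Qed.

Lemma sqr_mod8 (a : int) : (a %% 2 = 1)%Z -> exists k, a ^+ 2 = 8 * k + 1.
Proof.
move=> a2; have [m ->] : exists m, a = 2 * m + 1 by exists (a %/ 2)%Z; lia.
have [n E] : exists n, m * (m + 1) = 2 * n.
  have [h|h] : (m %% 2 = 0)%Z \/ (m %% 2 = 1)%Z by lia.
    exists ((m %/ 2)%Z * (m + 1)).
    by rewrite {1}(_ : m = 2 * (m %/ 2)%Z); [ring | lia].
  exists (m * ((m + 1) %/ 2)%Z).
  have e : m + 1 = 2 * ((m + 1) %/ 2)%Z by clear -h; lia.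
  by rewrite {1}e mulrCA.
exists n; transitivity (4 * (m * (m + 1)) + 1); first by ring.
by rewrite E; ring.
Qed.

Lemma even_parts (p : nat) (c d x y : int) : prime p -> (p %% 8 = 1)%N ->
  p%:Z = c ^+ 2 + d ^+ 2 -> p%:Z = x ^+ 2 + 10 * y ^+ 2 -> (c = 1 %[mod 4])%Z ->
  [/\ (d %% 4 = 0)%Z, (x %% 2 = 1)%Z & (y %% 2 = 0)%Z].
Proof.
move=> pp p8 pcd pxy c4.
have [k cE] : exists k, c ^+ 2 = 8 * k + 1 by apply: sqr_mod8; lia.
have [|x2] : (x %% 2 = 0)%Z \/ (x %% 2 = 1)%Z by lia.
  move=> x2; have xE : x = 2 * (x %/ 2)%Z by lia.
  move: pxy; rewrite xE; move: (x %/ 2)%Z => z.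
  have -> : (2 * z) ^+ 2 + 10 * y ^+ 2 = 2 * (2 * z ^+ 2 + 5 * y ^+ 2) by ring.
  move: (2 * _ + _) => w pw; exfalso; clear -p8 pw; lia.
have [m xE] := sqr_mod8 x2.
split=> //.
  have [d2|d2] : (d %% 2 = 0)%Z \/ (d %% 2 = 1)%Z by lia.
    have dE : d = 2 * (d %/ 2)%Z by lia.
    have [h|h] : ((d %/ 2)%Z %% 2 = 0)%Z \/ ((d %/ 2)%Z %% 2 = 1)%Z by clear; lia.
      by clear -dE h; lia.
    have [n nE] := sqr_mod8 h; exfalso.
    move: pcd; rewrite cE dE exprMn nE expr2; clear -p8; lia.
  have [n nE] := sqr_mod8 d2; exfalso.
  move: pcd; rewrite cE nE; clear -p8; lia.
have [//|y2] : (y %% 2 = 0)%Z \/ (y %% 2 = 1)%Z by lia.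
have [n nE] := sqr_mod8 y2; exfalso.
move: pxy; rewrite xE nE; clear -p8; lia.
Qed.

Lemma expr_N1_parity (K : fieldType) (u : K) (e : int) (k : 'Z_4) : u ^+ 2 = -1 ->
  k = e%:~R *+ 2 -> (-1) ^ e = expi u k.
Proof.
move=> u2 ->; rewrite -u2 exprnP exprz_exp -expi_int //; congr expi.
by rewrite rmorphM /= mulr_natl.
Qed.

(** Replacing x by - x changes the sign of the left-hand side of the first
    equation, which is made up for by k + 2, and the parity of e. *)
Lemma octic_value_odd (p : nat) (c d x y : int) : prime p -> (p %% 8 = 1)%N ->
  ~~ (5 %| p)%N -> p%:Z = c ^+ 2 + d ^+ 2 -> p%:Z = x ^+ 2 + 10 * y ^+ 2 ->
  (c = 1 %[mod 4])%Z ->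
  let u : 'F_p := groot (c, d) p in
  let e : int := (d %/ 4)%Z + ((x - 1) %/ 2)%Z + (y %/ 2)%Z in
  u ^+ 2 = -1 /\
  exists k : 'Z_4, expi (2 : 'F_5) k * x%:~R = (c + 2 * d)%:~R /\
    (-5 : 'F_p) ^+ ((p - 1) %/ 8) = expi u k * (-1) ^ e.
Proof.
move=> pp p8 p5 pcd pxy c4 u e.
have [d4 x2 y2] := even_parts pp p8 pcd pxy c4.
pose ga := ((c - 1) %/ 4)%Z; pose de := (d %/ 4)%Z; pose eta := (y %/ 2)%Z.
have cE : c = 4 * ga + 1 by rewrite /ga; clear -c4; lia.
have dE : d = 4 * de by rewrite /de; clear -d4; lia.
have yE : y = 2 * eta by rewrite /eta; clear -y2; lia.
have uE : u = groot (4 * ga + 1, 4 * de) p by rewrite /u cE dE.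
rewrite cE dE in pcd.
have u2 : u ^+ 2 = -1.
  rewrite uE; apply: place_sqr => //; first exact: prm_primary pp pcd.
  by rewrite /gnorm /= -pcd.
split=> //; have [x4|x4] : (x %% 4 = 1)%Z \/ (x %% 4 = 3)%Z by clear -x2; lia.
  pose xi := ((x - 1) %/ 4)%Z; have xE : x = 4 * xi + 1 by rewrite /xi; clear -x4; lia.
  rewrite xE yE in pxy; have [k [k1 k2]] := octic_value pp p5 pcd pxy.
  exists k; rewrite xE {1}cE {1}dE k1; split=> //.
  rewrite k2 -uE expiD //; congr (_ * _); symmetry; apply: expr_N1_parity => //.
  have -> : e = de + eta + 2 * xi by rewrite /e /de /eta /xi; clear -x4; lia.
  rewrite -mulr_natl; apply/eqP; rewrite -subr_eq0; apply/eqP.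
  rewrite -[RHS](Z4_four (- xi%:~R)); ring.
pose xi := ((- x - 1) %/ 4)%Z; have xE : x = - (4 * xi + 1) by rewrite /xi; clear -x4; lia.
rewrite xE yE sqrrN in pxy; have [k [k1 k2]] := octic_value pp p5 pcd pxy.
exists (k + 2); rewrite xE {1}cE {1}dE -k1; split.
  have v2 : (2 : 'F_5) ^+ 2 = -1 by apply/val_inj.
  by rewrite (expiD v2 k 2) (expi2 v2) mulrN1 rmorphN mulrNN.
rewrite k2 -uE (@expr_N1_parity _ u e (e%:~R *+ 2)) // -(expiD u2); congr (expi _ _).
have -> : e = de + eta - 2 * xi - 1 by rewrite /e /de /eta /xi; clear -x4; lia.
apply/eqP; rewrite -subr_eq0; apply/eqP.
by rewrite -[RHS](Z4_four xi%:~R); ring.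
Qed.

Theorem corollary4p5 (p r : nat) (c d d0 x y : int)
    (p_prime : prime p)
    (p_mod40 : p = 1 %[mod 40] \/ p = 9 %[mod 40])
    (p_cd : p%:Z = c ^+ 2 + d ^+ 2)
    (p_xy : p%:Z = x ^+ 2 + 10 * y ^+ 2)
    (c_mod4 : (c = 1 %[mod 4])%Z)
    (d_eq : d = 2 ^+ r * d0)
    (d0_mod4 : (d0 = 1 %[mod 4])%Z)
    (cop : gcdz c (x + d) = 1 \/ gcdz d0 (x + c) = 1) :
  let k : 'F_5 := frac_mod 5 (2 * c - d) x in
  let e : int := (d %/ 4)%Z + ((x - 1) %/ 2)%Z + (y %/ 2)%Z in
  let lhs : 'F_p := (-5) ^+ ((p - 1) %/ 8)%N in
  [/\ k = 2 -> lhs = (-1) ^ e,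
      k = -2 -> lhs = - (-1) ^ e,
      k = 1 -> lhs = (-1) ^ e * frac_mod p c d
    & k = -1 -> lhs = - ((-1) ^ e * frac_mod p c d)].
Proof.
move=> k e lhs.
have p8 : (p %% 8 = 1)%N by move: p_mod40; clear; lia.
have p5 : ~~ (5 %| p)%N by move: p_mod40; clear; lia.
have [u2 [m [mk lhsE]]] := octic_value_odd p_prime p8 p5 p_cd p_xy c_mod4.
rewrite /lhs lhsE -/e; set u := groot (c, d) p in u2 *.
have v2 : (2 : 'F_5) ^+ 2 = -1 by apply/val_inj.
have x5 : (x%:~R : 'F_5) != 0.
  rewrite intr_Fp_eq0 //; apply: contra p5 => x5.
  by rewrite -[(5 %| p)%N]/(5 %| p%:Z)%Z p_xy rpredD // ?expr2 ?dvdz_mulr.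
have kE : k = expi 2 (m + 1).
  apply: (mulIf x5); rewrite /k /frac_mod divfK // expiD // expi1 mulrAC mk.
  transitivity ((c + 2 * d)%:~R * 2 - 5 * d%:~R : 'F_5); first by ring.
  by rewrite (_ : 5 = 0 :> 'F_5) ?mul0r ?subr0 //; apply/val_inj.
have mE i : k = expi 2 (i + 1) -> m = i.
  by rewrite kE => /(expi_inj v2 isT) /addIr.
have -> : frac_mod p c d = - u by rewrite /u /groot /= mulNr opprK.
split=> k0.
- by rewrite (mE 0) ?k0 // expi0 mul1r.
- by rewrite (mE 2) ?k0 ?(expi2 u2) ?mulN1r //; apply/val_inj.
- have m3 : m = 3 by apply: mE; rewrite k0; apply/val_inj.
  by rewrite m3 (expi3 u2) mulrC.
- have m1 : m = 1 by apply: mE; rewrite k0; apply/val_inj.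
  by rewrite m1 (expi1 u) mulrN opprK mulrC.
Qed.
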